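(* Let $q\ge 3$ be an odd integer, let $l_1\neq 0$ and $\alpha\neq 0$ be real numbers, and let $\Phi:\mathbb{R}\to\mathbb{R}$ be a smooth function with $\Phi(s)=l_1 s+O(s^2)$ as $s\to 0$. Consider the one-parameter family of planar flows, written in the complex coordinate $z=x+iy$, $$\dot z = i\mu z + i\Phi(|z|^2)z + i\alpha (z^* )^{2q-1} + R(z,z^*,\mu),$$ where $\mu\in\mathbb{R}$ is a parameter, $R$ is smooth in $(x,y,\mu)$ with $R=O(|z|^{2q+1})$ uniformly for small $\mu$, and for every $\mu$ the vector field is divergence-free (area-preserving). Then there is a neighbourhood $U$ of $z=0$ such that for all sufficiently small $\mu\neq 0$: (i) if $\mu l_1>0$, the only equilibrium in $U$ is $z=0$, and it is a center; (ii) if $\mu l_1<0$, the flow has in $U$, besides the center $z=0$, exactly $4q$ nonzero equilibria $z_0,\dots,z_{4q-1}$ with $|z_k|^2=-\mu/l_1+O(\mu^2)$ and $\arg z_k = k\pi/(2q)+o(1)$ as $\mu\to0$; they are nondegenerate and alternate in type: if $\alpha l_1>0$, the $z_k$ with $k$ even are saddles and those with $k$ odd are centers, while if $\alpha l_1<0$, the $z_k$ with $k$ even are centers and those with $k$ odd are saddles. Thus they form a ring (''garland'') of $2q$ saddles and $2q$ centers.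
   Context: $z^*$ denotes the complex conjugate of $z$. A center is a nondegenerate equilibrium with purely imaginary nonzero eigenvalues (for an area-preserving planar flow it is surrounded by closed orbits); a saddle is an equilibrium with real eigenvalues of opposite signs. This flow is the flow normal form for a centrally symmetric ($f(-z)=-f(z)$) area-preserving planar map with an elliptic fixed point of multiplier $e^{2\pi i p/q}$, $q$ odd. *)

(* Defs.v *)
From Stdlib Require Import Reals List.
From Coquelicot Require Import Coquelicot.
Open Scope R_scope.

Definition smooth1 (f : R -> R) : Prop :=
  forall (n : nat) (x : R), ex_derive_n f n x.

Definition dir3 (i : nat) (g : R -> R -> R -> R) (x y m : R) : R -> R :=
  fun t => match i with
           | O => g (x + t) y m
           | S O => g x (y + t) m
           | _ => g x y (m + t)
           end.

Definition partial3 (i : nat) (g : R -> R -> R -> R) : R -> R -> R -> R :=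
  fun x y m => Derive (dir3 i g x y m) 0.

Fixpoint iter_partial3 (l : list nat) (g : R -> R -> R -> R) : R -> R -> R -> R :=
  match l with
  | nil => g
  | i :: l' => partial3 i (iter_partial3 l' g)
  end.

Definition uncurry3 (g : R -> R -> R -> R) : (R * R) * R -> R :=
  fun p => g (fst (fst p)) (snd (fst p)) (snd p).

Definition smooth3 (g : R -> R -> R -> R) : Prop :=
  forall l : list nat,
    (forall x y m, continuous (uncurry3 (iter_partial3 l g)) ((x, y), m)) /\
    (forall (i : nat) x y m, (i < 3)%nat -> ex_derive (dir3 i (iter_partial3 l g) x y m) 0).

Definition smoothC3 (Rf : C -> R -> C) : Prop :=
  smooth3 (fun x y m => fst (Rf (x, y) m)) /\
  smooth3 (fun x y m => snd (Rf (x, y) m)).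

Definition reF (F : C -> C) : C -> R := fun z => fst (F z).
Definition imF (F : C -> C) : C -> R := fun z => snd (F z).

Definition dx (u : C -> R) (p : C) : R := Derive (fun t => u (fst p + t, snd p)) 0.
Definition dy (u : C -> R) (p : C) : R := Derive (fun t => u (fst p, snd p + t)) 0.

Definition has_partials (F : C -> C) (p : C) : Prop :=
  ex_derive (fun t => reF F (fst p + t, snd p)) 0 /\
  ex_derive (fun t => reF F (fst p, snd p + t)) 0 /\
  ex_derive (fun t => imF F (fst p + t, snd p)) 0 /\
  ex_derive (fun t => imF F (fst p, snd p + t)) 0.

Definition divergence (F : C -> C) (p : C) : R :=
  dx (reF F) p + dy (imF F) p.

Definition jac_a (F : C -> C) p := dx (reF F) p.
Definition jac_b (F : C -> C) p := dy (reF F) p.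
Definition jac_c (F : C -> C) p := dx (imF F) p.
Definition jac_d (F : C -> C) p := dy (imF F) p.

Definition is_eigenvalue (F : C -> C) (p : C) (lam : C) : Prop :=
  ((RtoC (jac_a F p) - lam) * (RtoC (jac_d F p) - lam)
     - RtoC (jac_b F p) * RtoC (jac_c F p) = 0)%C.

Definition is_equilibrium (F : C -> C) (p : C) : Prop := F p = 0%C.

Definition nondegenerate (F : C -> C) (p : C) : Prop :=
  has_partials F p /\ jac_a F p * jac_d F p - jac_b F p * jac_c F p <> 0.

Definition is_center (F : C -> C) (p : C) : Prop :=
  is_equilibrium F p /\ nondegenerate F p /\
  forall lam : C, is_eigenvalue F p lam -> Re lam = 0 /\ lam <> 0%C.

Definition is_saddle (F : C -> C) (p : C) : Prop :=
  is_equilibrium F p /\ nondegenerate F p /\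
  (forall lam : C, is_eigenvalue F p lam -> Im lam = 0) /\
  exists l1 l2 : R, l1 < 0 < l2 /\
    is_eigenvalue F p (RtoC l1) /\ is_eigenvalue F p (RtoC l2).

Definition garland_field (q : nat) (alpha : R) (Phi : R -> R) (Rf : C -> R -> C)
  (mu : R) : C -> C :=
  fun z => (Ci * RtoC mu * z + Ci * RtoC (Phi ((Cmod z ^ 2)%R)) * z
            + Ci * RtoC alpha * Cpow (Cconj z) (2 * q - 1) + Rf z mu)%C.

(* Main.v *)
(* Writing z = a r e^(it), the equilibrium equations become mu + l1 a^2 (r^2 + E1) = 0 and
   sin (2 q t) + E2 = 0.  On 1/2 <= r <= 2 the errors E1, E2 are O(a^2) together with their
   Lipschitz constants: a function O(|z|^(2q+1)) with bounded derivatives of order 2q+1 has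
   first derivatives O(|z|^(2q)).  Taking a^2 = - mu / l1, each of the 4q sectors around
   t = k pi / (2q) contains exactly one solution.  The linearization is traceless, so its
   determinant decides the type; at an equilibrium the determinant is
   - 4 q l1 alpha |z|^(2q) cos (2 q t) up to a relative error O(|z|^2). *)
Require Import Defs.
From Stdlib Require Import Reals ZArith List Factorial Lra Lia ClassicalEpsilon.
From Coquelicot Require Import Coquelicot.
Open Scope R_scope.


(** * Derivatives of flat functions *)

(** The remainder is bounded only in value, whereas solving the equations takes Lipschitz constants
    and the determinant takes first partials. An interpolation inequality on coordinate segments
    bridges the gap: a small function with one bounded high derivative has a small first derivative,
    with constants uniform in the parameter.

    The polar system is solved with Lipschitz estimates alone. Each equation is strictly monotone in
    its own unknown and nearly independent of the other one, so two nested intermediate value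
    arguments give existence and diagonal dominance gives uniqueness.

    In the error bounds the scale [a] and the parameter are independent, because two scales occur: a
    = |z| with r = 1 locates an unknown equilibrium and forces the sign of mu l1, while a^2 = - mu /
    l1 gives all sectors the same normal form.

    The determinant is delicate because the terms with the derivative of [Phi] form a matrix of rank
    one: their products of order r^4 cancel, and the deciding term has order r^(2q). It emerges once
    mu + Phi is eliminated by the equilibrium equation. *)

(* Richardson extrapolation: P(t) - 2^n P(t/2) has no term of degree n. *)
Lemma linear_coefficient_bound (n : nat) :
  exists K, 0 <= K /\ forall (a : nat -> R) (B : R),
    (forall t, 0 <= t <= 1 -> Rabs (sum_f_R0 (fun m => a m * t ^ m) (S n)) <= B) ->
    Rabs (a 1%nat) <= K * B.
Proof.
induction n as [|n [K [HK IH]]].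
- exists 2; split; [lra|]; intros a B H.
  assert (H0 := H 0 ltac:(lra)); assert (H1 := H 1 ltac:(lra)); simpl in H0, H1.
  apply Rabs_le_between in H0; apply Rabs_le_between in H1.
  apply Rabs_le; lra.
- exists (K * (1 + 2 ^ S (S n))).
  assert (H2 : 0 < 2 ^ S (S n)) by (apply pow_lt; lra).
  split; [apply Rmult_le_pos; lra|]; intros a B H.
  set (b := fun m => a m * (1 - 2 ^ S (S n) * (/ 2) ^ m)).
  assert (Hb : Rabs (b 1%nat) <= K * ((1 + 2 ^ S (S n)) * B)).
  { apply IH; intros t Ht.
    replace (sum_f_R0 (fun m => b m * t ^ m) (S n))
      with (sum_f_R0 (fun m => a m * t ^ m) (S (S n))
            - 2 ^ S (S n) * sum_f_R0 (fun m => a m * (t * / 2) ^ m) (S (S n))).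
    - eapply Rle_trans; [apply Rabs_triang|].
      rewrite Rabs_Ropp, Rabs_mult, (Rabs_pos_eq (2 ^ _)) by lra.
      rewrite Rmult_plus_distr_r, Rmult_1_l.
      apply Rplus_le_compat; [apply H; lra|].
      apply Rmult_le_compat_l; [lra|apply H; lra].
    - rewrite !(tech5 _ (S n)).
      rewrite Rmult_plus_distr_l, scal_sum.
      replace (2 ^ S (S n) * (a (S (S n)) * (t * / 2) ^ S (S n)))
        with (a (S (S n)) * t ^ S (S n)).
      2: { rewrite Rpow_mult_distr, pow_inv; field; apply pow_nonzero; lra. }
      match goal with |- ?A + ?x - (?B + ?x) = _ => replace (A + x - (B + x)) with (A - B) by ring end.
      rewrite <- minus_sum.
      apply sum_eq; intros i _; unfold b; rewrite Rpow_mult_distr; ring. }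
  unfold b in Hb; rewrite Rabs_mult in Hb.
  (* The extrapolation multiplies the linear coefficient by 1 - 2^(n+1), whose absolute value is at
     least 1, so a bound for the new coefficient also bounds the old one. *)
  assert (H4 : 1 <= Rabs (1 - 2 ^ S (S n) * (/ 2) ^ 1)).
  { assert (1 <= 2 ^ n) by (apply pow_R1_Rle; lra).
    rewrite Rabs_minus_sym; eapply Rle_trans; [|apply Rle_abs]; simpl; lra. }
  rewrite Rmult_assoc; eapply Rle_trans; [|exact Hb].
  rewrite <- (Rmult_1_r (Rabs (a 1%nat))) at 1.
  apply Rmult_le_compat_l; [apply Rabs_pos|exact H4].
Qed.

(** The Taylor polynomial of [f] at [x], rescaled from [x, x + h] to [0, 1], differs from [f] by at
    most M h^(n+2), so it is bounded by A + M h^(n+2); its linear coefficient is h f'(x). The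
    constant depends on the degree only. *)
Lemma derivative_interpolation (n : nat) :
  exists K, 0 <= K /\ forall (f : R -> R) (x h A M : R), 0 < h ->
    (forall t k, x <= t <= x + h -> (k <= S (S n))%nat -> ex_derive_n f k t) ->
    (forall t, x <= t <= x + h -> Rabs (f t) <= A) ->
    (forall t, x <= t <= x + h -> Rabs (Derive_n f (S (S n)) t) <= M) ->
    Rabs (Derive f x) * h <= K * (A + M * h ^ S (S n)).
Proof.
destruct (linear_coefficient_bound n) as [K [HK HC]].
exists K; split; [exact HK|]; intros f x h A M Hh Hd HA HM.
replace (Rabs (Derive f x) * h) with (Rabs (h ^ 1 / INR (fact 1) * Derive_n f 1 x)).
2: { change (Derive_n f 1 x) with (Derive f x); rewrite Rabs_mult.
     replace (h ^ 1 / INR (fact 1)) with h by (simpl; field).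
     rewrite (Rabs_pos_eq h) by lra; ring. }
apply (HC (fun m => h ^ m / INR (fact m) * Derive_n f m x)).
intros t Ht.
assert (HM0 : 0 <= M).
{ eapply Rle_trans; [|apply (HM x); lra]; apply Rabs_pos. }
assert (Hh0 : 0 <= M * h ^ S (S n)).
{ apply Rmult_le_pos; [exact HM0|apply pow_le; lra]. }
(* [Taylor_Lagrange] compares two distinct points, so t = 0 is treated apart: only the constant term
   f(x) survives there. *)
destruct (Req_dec t 0) as [->|Ht0].
- rewrite (decomp_sum _ (S n)) by lia.
  rewrite (sum_eq _ (fun _ => 0)).
  2: { intros i _; simpl; ring. }
  rewrite sum_cte; simpl (0 ^ 0); simpl (h ^ 0); simpl (INR (fact 0)).
  change (Derive_n f 0 x) with (f x).
  replace (1 / 1 * f x * 1 + _) with (f x) by field.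
  assert (H := HA x ltac:(lra)); lra.
- assert (Hth : 0 < t * h) by (apply Rmult_lt_0_compat; lra).
  assert (Hth' : t * h <= h).
  { rewrite <- (Rmult_1_l h) at 2; apply Rmult_le_compat_r; lra. }
  destruct (Taylor_Lagrange f (S n) x (x + t * h)) as [z [Hz Heq]]; [lra| |].
  { intros u Hu k Hk; apply Hd; [lra|exact Hk]. }
  replace (x + t * h - x) with (t * h) in Heq by ring.
  rewrite (sum_eq _ (fun m => (t * h) ^ m / INR (fact m) * Derive_n f m x)).
  2: { intros i _; rewrite Rpow_mult_distr; unfold Rdiv; ring. }
  match type of Heq with _ = ?S0 + ?E =>
    replace S0 with (f (x + t * h) - E) by (rewrite Heq; ring) end.
  eapply Rle_trans; [apply Rabs_triang|]; rewrite Rabs_Ropp.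
  apply Rplus_le_compat; [apply HA; lra|].
  rewrite Rabs_mult, Rmult_comm.
  apply Rmult_le_compat; [apply Rabs_pos|apply Rabs_pos|apply HM; lra|].
  assert (Hf : 1 <= INR (fact (S (S n)))).
  { apply (le_INR 1); apply lt_O_fact. }
  rewrite Rabs_pos_eq.
  2: { apply Rle_mult_inv_pos; [apply pow_le; lra|lra]. }
  apply Rle_trans with ((t * h) ^ S (S n)).
  + rewrite <- (Rmult_1_r ((t * h) ^ S (S n))) at 2.
    apply Rmult_le_compat_l; [apply pow_le; lra|].
    rewrite <- Rinv_1; apply Rinv_le_contravar; lra.
  + apply pow_incr; lra.
Qed.

(** * Partial derivatives along coordinate lines *)

Lemma Derive_shift (f : R -> R) (s : R) :
  Derive (fun t => f (s + t)) 0 = Derive f s.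
Proof.
unfold Derive; apply f_equal; apply Lim_ext; intros h.
now rewrite Rplus_0_l, Rplus_0_r.
Qed.

Lemma ex_derive_shift (f : R -> R) (s : R) :
  ex_derive (fun t => f (s + t)) 0 -> ex_derive f s.
Proof.
intros H.
apply (ex_derive_ext (fun u => (fun t => f (s + t)) (u - s))).
- intros u; f_equal; ring.
- apply (ex_derive_comp (fun t => f (s + t)) (fun u => u - s)).
  + replace (s - s) with 0 by ring; exact H.
  + auto_derive; trivial.
Qed.

Definition move3 (i : nat) (s : R) (p : R * R * R) : R * R * R :=
  match p with
  | (x, y, m) =>
    match i with O => (x + s, y, m) | S O => (x, y + s, m) | _ => (x, y, m + s) end
  end.

Lemma dir3_add (i : nat) (g : R -> R -> R -> R) (x y m s t : R) :
  dir3 i g x y m (s + t) =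
  match move3 i s (x, y, m) with (x', y', m') => dir3 i g x' y' m' t end.
Proof. destruct i as [|[|i]]; simpl; f_equal; ring. Qed.

Lemma dir3_move (i : nat) (g : R -> R -> R -> R) (x y m s : R) :
  dir3 i g x y m s = match move3 i s (x, y, m) with (x', y', m') => g x' y' m' end.
Proof. destruct i as [|[|i]]; reflexivity. Qed.

(** [partial3] differentiates at displacement 0 only. Translating the base point moves this to any
    displacement, so that one-variable theorems apply on whole coordinate segments. *)
Lemma Derive_dir3 (i : nat) (g : R -> R -> R -> R) (x y m s : R) :
  Derive (dir3 i g x y m) s = dir3 i (partial3 i g) x y m s.
Proof.
rewrite dir3_move, <- Derive_shift.
rewrite (Derive_ext _ _ 0 (dir3_add i g x y m s)).
now destruct i as [|[|i]].
Qed.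

Lemma ex_derive_dir3 (l : list nat) (i : nat) (g : R -> R -> R -> R) (x y m s : R) :
  smooth3 g -> (i < 3)%nat -> ex_derive (dir3 i (iter_partial3 l g) x y m) s.
Proof.
intros Hg Hi; apply ex_derive_shift.
eapply ex_derive_ext; [intros t; symmetry; apply dir3_add|].
destruct (Hg l) as [_ Hd].
destruct i as [|[|i]]; [exact (Hd _ (x + s) y m Hi)|exact (Hd _ x (y + s) m Hi)|].
exact (Hd _ x y (m + s) Hi).
Qed.

Lemma Derive_n_dir3 (i : nat) (g : R -> R -> R -> R) (x y m : R) (n : nat) (s : R) :
  Derive_n (dir3 i g x y m) n s = dir3 i (iter_partial3 (repeat i n) g) x y m s.
Proof.
revert s; induction n as [|n IH]; intros s; [reflexivity|].
simpl; rewrite (Derive_ext _ _ s IH), Derive_dir3; reflexivity.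
Qed.

Lemma ex_derive_n_dir3 (i : nat) (g : R -> R -> R -> R) (x y m : R) (n : nat) (s : R) :
  smooth3 g -> (i < 3)%nat -> ex_derive_n (dir3 i g x y m) n s.
Proof.
intros Hg Hi; destruct n as [|n]; [exact I|]; simpl.
apply (ex_derive_ext (dir3 i (iter_partial3 (repeat i n) g) x y m)).
- intros t; symmetry; apply Derive_n_dir3.
- now apply ex_derive_dir3.
Qed.

(** Joint continuity at the origin, parameter included, is what makes the bound uniform in [m]. It
    supplies the high-derivative bound of the interpolation inequality. *)
Lemma smooth3_locally_bounded (l : list nat) (g : R -> R -> R -> R) :
  smooth3 g -> exists M d, 0 < d /\ forall x y m, Rabs x < d -> Rabs y < d -> Rabs m < d ->
    Rabs (iter_partial3 l g x y m) <= M.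
Proof.
intros Hg; destruct (Hg l) as [Hc _].
specialize (Hc 0 0 0).
set (v := iter_partial3 l g 0 0 0).
assert (HP : locally ((0, 0), 0) (fun p => Rabs (uncurry3 (iter_partial3 l g) p - v) < 1)).
{ apply (Hc (fun u => Rabs (u - v) < 1)).
  exists (mkposreal 1 Rlt_0_1); intros u Hu; exact Hu. }
destruct HP as [d Hd].
exists (Rabs v + 1), d; split; [apply cond_pos|]; intros x y m Hx Hy Hm.
assert (H : Rabs (uncurry3 (iter_partial3 l g) ((x, y), m) - v) < 1).
{ apply Hd; split; [split|]; unfold ball; simpl; unfold AbsRing_ball, abs, minus, plus, opp;
    simpl; rewrite Ropp_0, Rplus_0_r; assumption. }
unfold uncurry3 in H; simpl in H.
replace (iter_partial3 l g x y m) with (v + (iter_partial3 l g x y m - v)) by ring.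
eapply Rle_trans; [apply Rabs_triang|]; lra.
Qed.

(** Interpolation on a segment of length [h] starting at (x, y): the values and the derivative of
    order n + 2 both contribute O(h^(n+2)), and dividing by [h] costs one order. The segment may
    leave the box of size [h] but stays in that of size 2h, whence the power of 2 and the halved
    radius. *)
Lemma flat_partial_bound (n i : nat) (g : R -> R -> R -> R) (K d : R) :
  (i < 2)%nat -> smooth3 g -> 0 < d ->
  (forall h x y m, 0 < h < d -> Rabs x <= h -> Rabs y <= h -> Rabs m < d ->
     Rabs (g x y m) <= K * h ^ S (S n)) ->
  exists K' d', 0 <= K' /\ 0 < d' /\
    forall h x y m, 0 < h < d' -> Rabs x <= h -> Rabs y <= h -> Rabs m < d' ->
      Rabs (partial3 i g x y m) <= K' * h ^ S n.
Proof.
intros Hi Hg Hd Hflat.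
destruct (smooth3_locally_bounded (repeat i (S (S n))) g Hg) as [M [e [He HM]]].
destruct (derivative_interpolation n) as [C [HC HL]].
set (K1 := Rabs K * 2 ^ S (S n) + Rabs M).
assert (HK1 : 0 <= K1).
{ unfold K1; apply Rplus_le_le_0_compat; [|apply Rabs_pos].
  apply Rmult_le_pos; [apply Rabs_pos|apply pow_le; lra]. }
exists (C * K1), (Rmin d e / 2).
assert (Hde : 0 < Rmin d e) by (apply Rmin_glb_lt; assumption).
assert (Hmd := Rmin_l d e); assert (Hme := Rmin_r d e).
split; [apply Rmult_le_pos; assumption|]; split; [lra|].
intros h x y m Hh Hx Hy Hm.
assert (HLf := HL (dir3 i g x y m) 0 h (Rabs K * (2 * h) ^ S (S n)) (Rabs M)).
assert (Hpos : 0 < h ^ S n) by (apply pow_lt; lra).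
apply (Rmult_le_reg_r h); [lra|].
change (partial3 i g x y m) with (Derive (dir3 i g x y m) 0).
eapply Rle_trans; [apply HLf|].
- lra.
- intros t k _ _; apply ex_derive_n_dir3; [exact Hg|lia].
- intros t Ht; rewrite dir3_move.
  assert (Habs : forall u, Rabs u <= h -> Rabs (u + t) <= 2 * h).
  { intros u Hu; eapply Rle_trans; [apply Rabs_triang|].
    rewrite (Rabs_pos_eq t); lra. }
  apply Rle_trans with (K * (2 * h) ^ S (S n)).
  + destruct i as [|[|i]]; [| |lia]; simpl; apply Hflat; try apply Habs; try assumption; lra.
  + apply Rmult_le_compat_r; [apply pow_le; lra|apply Rle_abs].
- intros t Ht; rewrite Derive_n_dir3, dir3_move.
  assert (Habs : forall u, Rabs u <= h -> Rabs (u + t) < e).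
  { intros u Hu; eapply Rle_lt_trans; [apply Rabs_triang|].
    rewrite (Rabs_pos_eq t); lra. }
  eapply Rle_trans; [|apply Rle_abs].
  destruct i as [|[|i]]; [| |lia]; cbn [move3]; apply HM; try apply Habs; try assumption; lra.
- right; unfold K1; rewrite Rpow_mult_distr; simpl; ring.
Qed.

Lemma lipschitz_of_derive (f : R -> R) (lo hi M a b : R) :
  (forall t, lo <= t <= hi -> ex_derive f t /\ Rabs (Derive f t) <= M) ->
  lo <= a <= hi -> lo <= b <= hi -> Rabs (f b - f a) <= M * Rabs (b - a).
Proof.
intros H Ha Hb.
assert (Hm : forall t, Rmin a b <= t <= Rmax a b -> lo <= t <= hi).
{ intros t; unfold Rmin, Rmax; destruct (Rle_dec a b); lra. }
destruct (MVT_gen f a b (Derive f)) as [c [Hc Heq]].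
- intros t Ht; apply Derive_correct, H, Hm; lra.
- intros t Ht; apply derivable_continuous_pt, ex_derive_Reals_0, H, Hm; lra.
- rewrite Heq, Rabs_mult; apply Rmult_le_compat_r; [apply Rabs_pos|].
  apply H, Hm, Hc.
Qed.

(** The path that changes first [x] and then [y] stays in the box, so the mean value theorem applies
    to each leg. *)
Lemma flat_lipschitz (n : nat) (g : R -> R -> R -> R) (K d : R) :
  smooth3 g -> 0 < d ->
  (forall h x y m, 0 < h < d -> Rabs x <= h -> Rabs y <= h -> Rabs m < d ->
     Rabs (g x y m) <= K * h ^ S (S n)) ->
  exists K' d', 0 <= K' /\ 0 < d' /\
    forall h x y x' y' m, 0 < h < d' -> Rabs m < d' ->
      Rabs x <= h -> Rabs y <= h -> Rabs x' <= h -> Rabs y' <= h ->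
      Rabs (g x y m - g x' y' m) <= K' * h ^ S n * (Rabs (x - x') + Rabs (y - y')).
Proof.
intros Hg Hd Hflat.
destruct (flat_partial_bound n 0 g K d) as [K0 [d0 [HK0 [Hd0 H0]]]]; auto.
destruct (flat_partial_bound n 1 g K d) as [K1 [d1 [HK1 [Hd1 H1]]]]; auto.
exists (K0 + K1), (Rmin d0 d1); split; [lra|].
split; [apply Rmin_glb_lt; assumption|].
assert (Hm0 := Rmin_l d0 d1); assert (Hm1 := Rmin_r d0 d1).
intros h x y x' y' m Hh Hm Hx Hy Hx' Hy'.
apply Rabs_le_between in Hx; apply Rabs_le_between in Hx'.
apply Rabs_le_between in Hy; apply Rabs_le_between in Hy'.
assert (Hpos : 0 < h ^ S n) by (apply pow_lt; lra).
assert (Ex : Rabs (g x y m - g x' y m) <= K0 * h ^ S n * Rabs (x - x')).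
{ replace (g x y m - g x' y m) with (dir3 0 g 0 y m x - dir3 0 g 0 y m x').
  2: { simpl; now rewrite !Rplus_0_l. }
  apply (lipschitz_of_derive _ (- h) h); try lra.
  intros t Ht; split; [apply (ex_derive_dir3 nil); [exact Hg|lia]|].
  rewrite Derive_dir3; simpl; rewrite Rplus_0_l.
  apply H0; try (apply Rabs_le); lra. }
assert (Ey : Rabs (g x' y m - g x' y' m) <= K1 * h ^ S n * Rabs (y - y')).
{ replace (g x' y m - g x' y' m) with (dir3 1 g x' 0 m y - dir3 1 g x' 0 m y').
  2: { simpl; now rewrite !Rplus_0_l. }
  apply (lipschitz_of_derive _ (- h) h); try lra.
  intros t Ht; split; [apply (ex_derive_dir3 nil); [exact Hg|lia]|].
  rewrite Derive_dir3; simpl; rewrite Rplus_0_l.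
  apply H1; try (apply Rabs_le); lra. }
replace (g x y m - g x' y' m) with (g x y m - g x' y m + (g x' y m - g x' y' m)) by ring.
eapply Rle_trans; [apply Rabs_triang|].
assert (Px := Rabs_pos (x - x')); assert (Py := Rabs_pos (y - y')).
assert (Q0 : 0 <= K1 * h ^ S n * Rabs (x - x')).
{ apply Rmult_le_pos; [|exact Px]; apply Rmult_le_pos; lra. }
assert (Q1 : 0 <= K0 * h ^ S n * Rabs (y - y')).
{ apply Rmult_le_pos; [|exact Py]; apply Rmult_le_pos; lra. }
lra.
Qed.

(** The expansion of [Phi] is a statement about values; the control of its derivative comes from
    interpolating Phi(s) - l1 s with a bound on the second derivative near 0. *)
Lemma frequency_derivative_bound (Phi : R -> R) (l1 : R) :
  smooth1 Phi ->
  (exists K d, 0 < d /\ forall s, Rabs s < d -> Rabs (Phi s - l1 * s) <= K * s ^ 2) ->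
  exists M d, 0 <= M /\ 0 < d /\ forall h s, 0 < h < d -> Rabs s <= h ->
    Rabs (Phi s - l1 * s) <= M * h ^ 2 /\ Rabs (Derive Phi s - l1) <= M * h.
Proof.
intros HPhi [K [d [Hd HK]]].
destruct (derivative_interpolation 0) as [C [HC HL]].
set (f := fun s => Phi s - l1 * s).
assert (D1 : forall s, Derive f s = Derive Phi s - l1).
{ intros s; unfold f; rewrite Derive_minus, Derive_scal, Derive_id; [ring| |].
  - exact (HPhi 1%nat s).
  - auto_derive; trivial. }
assert (D2 : forall s, Derive (Derive f) s = Derive_n Phi 2 s).
{ intros s; rewrite (Derive_ext _ _ s D1), Derive_minus, Derive_const.
  - rewrite Rminus_0_r; reflexivity.
  - exact (HPhi 2%nat s).
  - auto_derive; trivial. }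
assert (Hc : continuous (Derive_n Phi 2) 0).
{ apply (ex_derive_continuous (Derive_n Phi 2)); exact (HPhi 3%nat 0). }
assert (HP : locally 0 (fun s => Rabs (Derive_n Phi 2 s - Derive_n Phi 2 0) < 1)).
{ apply (Hc (fun u => Rabs (u - Derive_n Phi 2 0) < 1)).
  exists (mkposreal 1 Rlt_0_1); intros u Hu; exact Hu. }
destruct HP as [e He].
set (M2 := Rabs (Derive_n Phi 2 0) + 1).
assert (HM2 : 0 <= M2) by (assert (H := Rabs_pos (Derive_n Phi 2 0)); unfold M2; lra).
(* The segment [s, s + h] reaches 2h, and (2h)^2 = 4 h^2. *)
set (B := Rabs K * 4).
assert (HB : 0 <= B) by (apply Rmult_le_pos; [apply Rabs_pos|lra]).
assert (He0 := cond_pos e).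
assert (Hm : 0 < Rmin d e) by (apply Rmin_glb_lt; lra).
assert (Hml := Rmin_l d e); assert (Hmr := Rmin_r d e).
assert (HCB : 0 <= C * (B + M2)) by (apply Rmult_le_pos; lra).
exists (B + C * (B + M2)), (Rmin d e / 2).
split; [lra|]; split; [lra|].
intros h s Hh Hs.
assert (Hf : forall t, Rabs t <= 2 * h -> Rabs (f t) <= B * h ^ 2).
{ intros t Ht; apply Rle_trans with (K * t ^ 2); [apply HK; lra|].
  apply Rle_trans with (Rabs K * t ^ 2).
  - apply Rmult_le_compat_r; [apply pow2_ge_0|apply Rle_abs].
  - unfold B; rewrite Rmult_assoc; apply Rmult_le_compat_l; [apply Rabs_pos|].
    rewrite <- (pow2_abs t).
    replace (4 * h ^ 2) with ((2 * h) ^ 2) by ring.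
    apply pow_incr; split; [apply Rabs_pos|exact Ht]. }
assert (Hh2 : 0 <= h ^ 2) by apply pow2_ge_0.
split.
- eapply Rle_trans; [apply (Hf s); lra|].
  apply Rmult_le_compat_r; lra.
- rewrite <- D1; apply (Rmult_le_reg_r h); [lra|].
  assert (Hst : forall t, s <= t <= s + h -> Rabs t <= 2 * h).
  { intros t Ht; apply Rabs_le_between in Hs; apply Rabs_le; lra. }
  eapply Rle_trans; [apply (HL f s h (B * h ^ 2) M2)|].
  + lra.
  + intros t k _ Hk; destruct k as [|[|[|k]]]; [exact I| | |lia].
    * simpl; unfold f; apply (ex_derive_minus Phi (fun s => l1 * s)).
      -- exact (HPhi 1%nat t).
      -- auto_derive; trivial.
    * simpl; apply (ex_derive_ext (fun s => Derive Phi s - l1)).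
      -- intros u; symmetry; apply D1.
      -- apply (ex_derive_minus (Derive Phi) (fun _ => l1)).
         ++ exact (HPhi 2%nat t).
         ++ auto_derive; trivial.
  + intros t Ht; apply Hf, Hst, Ht.
  + intros t Ht; simpl; rewrite D2.
    replace (Derive_n Phi 2 t) with (Derive_n Phi 2 0 + (Derive_n Phi 2 t - Derive_n Phi 2 0)) by ring.
    eapply Rle_trans; [apply Rabs_triang|]; apply Rplus_le_compat_l, Rlt_le.
    apply He; unfold ball; simpl; unfold AbsRing_ball, abs, minus, plus, opp; simpl.
    rewrite Ropp_0, Rplus_0_r; assert (H := Hst t Ht); lra.
  + replace (C * (B * h ^ 2 + M2 * h ^ 2)) with (C * (B + M2) * h * h) by ring.
    apply Rmult_le_compat_r; [lra|]; apply Rmult_le_compat_r; lra.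
Qed.

(** * Planar systems of equations *)

Lemma ivt_lipschitz (f : R -> R) (a b L : R) :
  a <= b -> 0 <= L ->
  (forall x y, a <= x <= b -> a <= y <= b -> Rabs (f x - f y) <= L * Rabs (x - y)) ->
  f a <= 0 <= f b -> exists x, a <= x <= b /\ f x = 0.
Proof.
intros Hab HL Hl Hs.
(* [f] is controlled on [a, b] only, while [IVT_gen] asks for continuity on the whole line.
   Composing with the clamp [c], which is 1-Lipschitz and fixes [a, b], provides it. *)
set (c := fun x => Rmax a (Rmin b x)).
assert (Hc : forall x, a <= c x <= b).
{ intros x; unfold c, Rmax, Rmin; destruct (Rle_dec b x); destruct (Rle_dec a _); lra. }
assert (Hid : forall x, a <= x <= b -> c x = x).
{ intros x Hx; unfold c, Rmax, Rmin; destruct (Rle_dec b x); destruct (Rle_dec a _); lra. }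
assert (Hcl : forall x y, Rabs (c x - c y) <= Rabs (x - y)).
{ intros x y; unfold c, Rmax, Rmin.
  destruct (Rle_dec b x), (Rle_dec b y); repeat destruct (Rle_dec a _);
    unfold Rabs; repeat destruct (Rcase_abs _); lra. }
assert (Hcont : continuity (fun x => f (c x))).
{ intros x eps Heps.
  exists (eps / (L + 1)); split; [apply Rdiv_lt_0_compat; lra|].
  intros y [_ Hy]; simpl in *; unfold R_dist in *.
  eapply Rle_lt_trans; [apply Hl; apply Hc|].
  apply Rle_lt_trans with ((L + 1) * Rabs (y - x)).
  - apply Rmult_le_compat; [exact HL|apply Rabs_pos|lra|apply Hcl].
  - apply (Rmult_lt_compat_l (L + 1)) in Hy; [|lra].
    replace ((L + 1) * (eps / (L + 1))) with eps in Hy by (field; lra).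
    exact Hy. }
destruct (IVT_gen (fun x => f (c x)) a b 0 Hcont) as [x [_ Hx]].
- simpl; rewrite !Hid by lra; rewrite Rmin_left, Rmax_right; lra.
- exists (c x); split; [apply Hc|exact Hx].
Qed.

(** Diagonal dominance: passing through a mixed point gives m|dx| <= l|dy| and m|dy| <= l|dx| for
    the difference of two roots, and the sum of both forces it to vanish. *)
Lemma planar_root_unique (A B : R -> R -> R) (a b c d m l : R) :
  0 <= l < m ->
  (forall x x' y, a <= x <= b -> a <= x' <= b -> c <= y <= d ->
     m * Rabs (x - x') <= Rabs (A x y - A x' y)) ->
  (forall x y y', a <= x <= b -> c <= y <= d -> c <= y' <= d ->
     Rabs (A x y - A x y') <= l * Rabs (y - y')) ->
  (forall x y y', a <= x <= b -> c <= y <= d -> c <= y' <= d ->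
     m * Rabs (y - y') <= Rabs (B x y - B x y')) ->
  (forall x x' y, a <= x <= b -> a <= x' <= b -> c <= y <= d ->
     Rabs (B x y - B x' y) <= l * Rabs (x - x')) ->
  forall x y x' y', a <= x <= b -> c <= y <= d -> a <= x' <= b -> c <= y' <= d ->
    A x y = 0 -> B x y = 0 -> A x' y' = 0 -> B x' y' = 0 -> x = x' /\ y = y'.
Proof.
intros Hl HAx HAy HBy HBx x y x' y' Hx Hy Hx' Hy' HA HB HA' HB'.
assert (E1 : m * Rabs (x - x') <= l * Rabs (y - y')).
{ eapply Rle_trans; [apply (HAx x x' y Hx Hx' Hy)|].
  replace (A x y - A x' y) with (A x' y' - A x' y) by lra.
  rewrite (Rabs_minus_sym y); apply HAy; assumption. }
assert (E2 : m * Rabs (y - y') <= l * Rabs (x - x')).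
{ eapply Rle_trans; [apply (HBy x y y' Hx Hy Hy')|].
  replace (B x y - B x y') with (B x' y' - B x y') by lra.
  rewrite (Rabs_minus_sym x); apply HBx; assumption. }
assert (P1 := Rabs_pos (x - x')); assert (P2 := Rabs_pos (y - y')).
assert (E : (m - l) * (Rabs (x - x') + Rabs (y - y')) <= 0) by lra.
assert (E3 : Rabs (x - x') + Rabs (y - y') <= 0).
{ apply (Rmult_le_reg_l (m - l)); lra. }
assert (Z1 : Rabs (x - x') = 0) by lra; assert (Z2 : Rabs (y - y') = 0) by lra.
apply Rabs_eq_0 in Z1; apply Rabs_eq_0 in Z2; lra.
Qed.

(** For each [y] the intermediate value theorem solves A = 0 by some x = r(y). The expansion of [A]
    in [x] makes [r] Lipschitz with constant l/m, so y -> B(r(y), y) is Lipschitz and the theorem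
    applies once more. *)
Lemma planar_root_exists (A B : R -> R -> R) (a b c d m l L : R) :
  a <= b -> c <= d -> 0 < m -> 0 <= l -> 0 <= L ->
  (forall x x' y, a <= x <= b -> a <= x' <= b -> c <= y <= d ->
     m * Rabs (x - x') <= Rabs (A x y - A x' y) <= L * Rabs (x - x')) ->
  (forall x y y', a <= x <= b -> c <= y <= d -> c <= y' <= d ->
     Rabs (A x y - A x y') <= l * Rabs (y - y')) ->
  (forall x y y', a <= x <= b -> c <= y <= d -> c <= y' <= d ->
     Rabs (B x y - B x y') <= L * Rabs (y - y')) ->
  (forall x x' y, a <= x <= b -> a <= x' <= b -> c <= y <= d ->
     Rabs (B x y - B x' y) <= l * Rabs (x - x')) ->
  (forall y, c <= y <= d -> A a y <= 0 <= A b y) ->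
  (forall x, a <= x <= b -> B x c <= 0 <= B x d) ->
  exists x y, a <= x <= b /\ c <= y <= d /\ A x y = 0 /\ B x y = 0.
Proof.
intros Hab Hcd Hm Hl HL HAx HAy HBy HBx HA HB.
(* The range condition sits under the existential so that choice yields a total function; outside
   [c, d] the value 0 is a mere default. *)
assert (Hr : forall y, exists x, c <= y <= d -> a <= x <= b /\ A x y = 0).
{ intros y; destruct (Rle_dec c y) as [H1|H1]; [destruct (Rle_dec y d) as [H2|H2]|].
  2, 3: exists 0; lra.
  destruct (ivt_lipschitz (fun x => A x y) a b L Hab HL) as [x Hx].
  - intros x x' Hx Hx'; apply HAx; auto.
  - apply HA; auto.
  - exists x; auto. }
set (r := fun y => proj1_sig (constructive_indefinite_description _ (Hr y))).
assert (Hrs : forall y, c <= y <= d -> a <= r y <= b /\ A (r y) y = 0).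
{ intros y; exact (proj2_sig (constructive_indefinite_description _ (Hr y))). }
assert (Hrl : forall y y', c <= y <= d -> c <= y' <= d ->
          Rabs (r y - r y') <= l / m * Rabs (y - y')).
{ intros y y' Hy Hy'.
  destruct (Hrs y Hy) as [R1 R2]; destruct (Hrs y' Hy') as [R3 R4].
  apply (Rmult_le_reg_l m); [exact Hm|].
  replace (m * (l / m * Rabs (y - y'))) with (l * Rabs (y - y')) by (field; lra).
  destruct (HAx (r y) (r y') y R1 R3 Hy) as [E _].
  eapply Rle_trans; [exact E|].
  replace (A (r y) y - A (r y') y) with (A (r y') y' - A (r y') y) by lra.
  rewrite (Rabs_minus_sym y); apply HAy; assumption. }
assert (Hlm : 0 <= l / m) by (apply Rle_mult_inv_pos; assumption).
destruct (ivt_lipschitz (fun y => B (r y) y) c d (l * (l / m) + L) Hcd) as [y [Hy Hy0]].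
- assert (0 <= l * (l / m)) by (apply Rmult_le_pos; assumption); lra.
- intros y y' Hy Hy'; destruct (Hrs y Hy) as [R1 _]; destruct (Hrs y' Hy') as [R3 _].
  replace (B (r y) y - B (r y') y')
    with ((B (r y) y - B (r y') y) + (B (r y') y - B (r y') y')) by ring.
  eapply Rle_trans; [apply Rabs_triang|]; rewrite Rmult_plus_distr_r.
  apply Rplus_le_compat; [|apply HBy; assumption].
  eapply Rle_trans; [apply HBx; assumption|].
  rewrite Rmult_assoc; apply Rmult_le_compat_l; [exact Hl|]; apply Hrl; assumption.
- split; apply HB; apply Hrs; lra.
- exists (r y), y; destruct (Hrs y Hy); auto.
Qed.

(** * Bounded Lipschitz errors in polar coordinates *)

(** A single constant bounds both the size and the Lipschitz constant, on an annulus around r = 1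
    and for all angles. Sums and products stay in the class, so each error is tracked by one
    constant times a power of [a]. *)
Definition bounded_lip (K : R) (f : R -> R -> R) : Prop :=
  forall r t r' t', 1 / 2 <= r <= 2 -> 1 / 2 <= r' <= 2 ->
    Rabs (f r t) <= K /\ Rabs (f r t - f r' t') <= K * (Rabs (r - r') + Rabs (t - t')).

Lemma bounded_lip_pos (K : R) (f : R -> R -> R) : bounded_lip K f -> 0 <= K.
Proof.
intros H; destruct (H 1 0 1 0) as [H0 _]; try lra.
eapply Rle_trans; [apply Rabs_pos|exact H0].
Qed.

Lemma bounded_lip_weaken (K K' : R) (f : R -> R -> R) :
  K <= K' -> bounded_lip K f -> bounded_lip K' f.
Proof.
intros HK H r t r' t' Hr Hr'; destruct (H r t r' t' Hr Hr') as [H0 H1].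
split; [lra|]; eapply Rle_trans; [exact H1|].
apply Rmult_le_compat_r; [|exact HK].
apply Rplus_le_le_0_compat; apply Rabs_pos.
Qed.

Lemma bounded_lip_plus (K K' : R) (f g : R -> R -> R) :
  bounded_lip K f -> bounded_lip K' g -> bounded_lip (K + K') (fun r t => f r t + g r t).
Proof.
intros Hf Hg r t r' t' Hr Hr'.
destruct (Hf r t r' t' Hr Hr') as [F0 F1]; destruct (Hg r t r' t' Hr Hr') as [G0 G1].
split; [eapply Rle_trans; [apply Rabs_triang|]; lra|].
replace (f r t + g r t - (f r' t' + g r' t')) with (f r t - f r' t' + (g r t - g r' t')) by ring.
eapply Rle_trans; [apply Rabs_triang|]; lra.
Qed.

Lemma bounded_lip_mult (K K' : R) (f g : R -> R -> R) :
  bounded_lip K f -> bounded_lip K' g ->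
  bounded_lip (2 * (K * K')) (fun r t => f r t * g r t).
Proof.
intros Hf Hg r t r' t' Hr Hr'.
assert (K0 := bounded_lip_pos _ _ Hf); assert (K1 := bounded_lip_pos _ _ Hg).
destruct (Hf r t r' t' Hr Hr') as [F0 F1]; destruct (Hg r t r' t' Hr Hr') as [G0 G1].
destruct (Hg r' t' r t Hr' Hr) as [G0' _].
assert (KK : 0 <= K * K') by (apply Rmult_le_pos; assumption).
split.
- rewrite Rabs_mult; apply Rle_trans with (K * K'); [|lra].
  apply Rmult_le_compat; auto using Rabs_pos.
- replace (f r t * g r t - f r' t' * g r' t')
    with (f r t * (g r t - g r' t') + g r' t' * (f r t - f r' t')) by ring.
  eapply Rle_trans; [apply Rabs_triang|]; rewrite !Rabs_mult.
  set (D := Rabs (r - r') + Rabs (t - t')) in *.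
  assert (E0 : Rabs (f r t) * Rabs (g r t - g r' t') <= K * (K' * D)).
  { apply Rmult_le_compat; auto using Rabs_pos. }
  assert (E1 : Rabs (g r' t') * Rabs (f r t - f r' t') <= K' * (K * D)).
  { apply Rmult_le_compat; auto using Rabs_pos. }
  lra.
Qed.

Lemma bounded_lip_scal (c K : R) (f : R -> R -> R) :
  bounded_lip K f -> bounded_lip (Rabs c * K) (fun r t => f r t * c).
Proof.
intros Hf r t r' t' Hr Hr'; destruct (Hf r t r' t' Hr Hr') as [F0 F1]; split.
- rewrite Rabs_mult, Rmult_comm; apply Rmult_le_compat_l; [apply Rabs_pos|exact F0].
- rewrite <- Rmult_minus_distr_r, Rabs_mult, Rmult_comm, Rmult_assoc.
  apply Rmult_le_compat_l; [apply Rabs_pos|exact F1].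
Qed.

Lemma bounded_lip_pow (K : R) (f : R -> R -> R) (n : nat) :
  bounded_lip K f -> exists K', bounded_lip K' (fun r t => f r t ^ n).
Proof.
intros Hf; induction n as [|n [K' IH]].
- exists 1; intros r t r' t' _ _; simpl; rewrite Rminus_diag, Rabs_R0, Rabs_R1.
  split; [lra|]; rewrite Rmult_1_l; apply Rplus_le_le_0_compat; apply Rabs_pos.
- eexists; simpl; apply (bounded_lip_mult _ _ f _ Hf IH).
Qed.

Lemma bounded_lip_radius : bounded_lip 2 (fun r _ => r).
Proof.
intros r t r' t' Hr Hr'; split; [apply Rabs_le; lra|].
assert (H := Rabs_pos (r - r')); assert (H' := Rabs_pos (t - t')); lra.
Qed.

Lemma bounded_lip_inv_radius : bounded_lip 4 (fun r _ => / r).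
Proof.
intros r t r' t' Hr Hr'.
assert (I : forall u, 1 / 2 <= u <= 2 -> 0 < / u <= 2).
{ intros u Hu; split; [apply Rinv_0_lt_compat; lra|].
  rewrite <- (Rinv_inv 2); apply Rinv_le_contravar; lra. }
assert (I0 := I r Hr); assert (I1 := I r' Hr').
split; [apply Rabs_le; lra|].
replace (/ r - / r') with (/ r * / r' * (r' - r)) by (field; lra).
rewrite Rabs_mult, Rabs_pos_eq by (apply Rmult_le_pos; lra).
apply Rmult_le_compat; [apply Rmult_le_pos; lra|apply Rabs_pos| |].
- replace 4 with (2 * 2) by ring; apply Rmult_le_compat; lra.
- rewrite Rabs_minus_sym; assert (H := Rabs_pos (t - t')); lra.
Qed.

Lemma cos_lipschitz (x y : R) : Rabs (cos x - cos y) <= Rabs (x - y).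
Proof.
rewrite <- (Rmult_1_l (Rabs (x - y))).
apply (lipschitz_of_derive _ (Rmin x y) (Rmax x y)).
2, 3: unfold Rmin, Rmax; destruct (Rle_dec x y); lra.
intros t _.
assert (D : is_derive cos t (- sin t)) by (auto_derive; [trivial|ring]).
split; [eexists; exact D|]; rewrite (is_derive_unique _ _ _ D), Rabs_Ropp.
apply Rabs_le; destruct (SIN_bound t); lra.
Qed.

Lemma sin_lipschitz (x y : R) : Rabs (sin x - sin y) <= Rabs (x - y).
Proof.
rewrite <- !cos_shift, (Rabs_minus_sym x).
replace (y - x) with (PI / 2 - x - (PI / 2 - y)) by ring; apply cos_lipschitz.
Qed.

Lemma bounded_lip_cos : bounded_lip 1 (fun _ t => cos t).
Proof.
intros r t r' t' _ _; split; [apply Rabs_le; destruct (COS_bound t); lra|].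
assert (H := Rabs_pos (r - r')); assert (H' := cos_lipschitz t t'); lra.
Qed.

Lemma bounded_lip_sin : bounded_lip 1 (fun _ t => sin t).
Proof.
intros r t r' t' _ _; split; [apply Rabs_le; destruct (SIN_bound t); lra|].
assert (H := Rabs_pos (r - r')); assert (H' := sin_lipschitz t t'); lra.
Qed.

Lemma bounded_lip_cos_mult (w : R) : bounded_lip (1 + Rabs w) (fun _ t => cos (w * t)).
Proof.
intros r t r' t' _ _; assert (Hw := Rabs_pos w).
split; [apply Rabs_le; destruct (COS_bound (w * t)); lra|].
eapply Rle_trans; [apply cos_lipschitz|].
rewrite <- Rmult_minus_distr_l, Rabs_mult.
assert (H := Rabs_pos (r - r')); assert (H' := Rabs_pos (t - t')).
apply Rmult_le_compat; lra.
Qed.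

(** The order lost when passing from values to Lipschitz constants is regained from the chain rule:
    displacements in (r, t) move the point by O(a). Hence size and Lipschitz constant have the same
    order a^(n+2). *)
Lemma bounded_lip_polar (n : nat) (g : R -> R -> R -> R) (K d : R) :
  smooth3 g -> 0 < d ->
  (forall h x y m, 0 < h < d -> Rabs x <= h -> Rabs y <= h -> Rabs m < d ->
     Rabs (g x y m) <= K * h ^ S (S n)) ->
  exists K' d', 0 < d' /\ forall a m, 0 < a < d' -> Rabs m < d' ->
    bounded_lip (K' * a ^ S (S n)) (fun r t => g (a * r * cos t) (a * r * sin t) m).
Proof.
intros Hg Hd Hflat.
destruct (flat_lipschitz n g K d Hg Hd Hflat) as [L [e [HL [He HLip]]]].
assert (Hde : 0 < Rmin d e) by (apply Rmin_glb_lt; lra).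
assert (Hmd := Rmin_l d e); assert (Hme := Rmin_r d e).
(* The powers of 2 come from the box of size 2a, as r <= 2. The 8 is two coordinates times the
   Lipschitz constant 4 of r cos t and r sin t. *)
set (K1 := Rabs K * 2 ^ S (S n)); set (L1 := 8 * (L * 2 ^ S n)).
assert (HK1 : 0 <= K1) by (apply Rmult_le_pos; [apply Rabs_pos|apply pow_le; lra]).
assert (HL1 : 0 <= L1).
{ apply Rmult_le_pos; [lra|]; apply Rmult_le_pos; [exact HL|apply pow_le; lra]. }
exists (K1 + L1), (Rmin d e / 2); split; [lra|].
intros a m Ha Hm r t r' t' Hr Hr'.
assert (Hap : 0 < a ^ S (S n)) by (apply pow_lt; lra).
assert (Hb : forall u v w f, bounded_lip 1 f -> 1 / 2 <= u <= 2 -> w = f u v ->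
               Rabs (a * u * w) <= 2 * a).
{ intros u v w f Hf Hu ->; destruct (Hf u v u v Hu Hu) as [Hf0 _].
  rewrite Rabs_mult, (Rabs_pos_eq (a * u)) by (apply Rmult_le_pos; lra).
  replace (2 * a) with (a * 2 * 1) by ring.
  apply Rmult_le_compat; [apply Rmult_le_pos; lra|apply Rabs_pos| |exact Hf0].
  apply Rmult_le_compat_l; lra. }
assert (Hc : forall u v, 1 / 2 <= u <= 2 -> Rabs (a * u * cos v) <= 2 * a).
{ intros u v Hu; exact (Hb u v _ _ bounded_lip_cos Hu eq_refl). }
assert (Hs : forall u v, 1 / 2 <= u <= 2 -> Rabs (a * u * sin v) <= 2 * a).
{ intros u v Hu; exact (Hb u v _ _ bounded_lip_sin Hu eq_refl). }
split.
- apply Rle_trans with (K * (2 * a) ^ S (S n)); [apply Hflat; auto; lra|].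
  apply Rle_trans with (Rabs K * (2 * a) ^ S (S n)).
  + apply Rmult_le_compat_r; [apply pow_le; lra|apply Rle_abs].
  + rewrite Rpow_mult_distr, <- Rmult_assoc; fold K1.
    apply Rmult_le_compat_r; lra.
- eapply Rle_trans; [apply (HLip (2 * a)); auto; lra|].
  assert (Hl : forall f, bounded_lip 1 f ->
    Rabs (a * r * f r t - a * r' * f r' t') <= a * (4 * (Rabs (r - r') + Rabs (t - t')))).
  { intros f Hf.
    destruct (bounded_lip_mult _ _ _ _ bounded_lip_radius Hf r t r' t' Hr Hr') as [_ H].
    replace (a * r * f r t - a * r' * f r' t') with (a * (r * f r t - r' * f r' t')) by ring.
    rewrite Rabs_mult, Rabs_pos_eq by lra.
    apply Rmult_le_compat_l; [lra|]; lra. }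
  assert (E0 := Hl _ bounded_lip_cos); assert (E1 := Hl _ bounded_lip_sin).
  simpl in E0, E1.
  set (D := Rabs (r - r') + Rabs (t - t')) in *.
  assert (HD : 0 <= D) by (apply Rplus_le_le_0_compat; apply Rabs_pos).
  apply Rle_trans with (L * (2 * a) ^ S n * (8 * (a * D))).
  + apply Rmult_le_compat_l; [|lra].
    apply Rmult_le_pos; [exact HL|apply pow_le; lra].
  + replace (L * (2 * a) ^ S n * (8 * (a * D))) with (L1 * a ^ S (S n) * D).
    2: { unfold L1; rewrite Rpow_mult_distr; simpl; ring. }
    apply Rmult_le_compat_r; [exact HD|]; apply Rmult_le_compat_r; lra.
Qed.

Lemma pow_le_square (a : R) (n : nat) : 0 < a <= 1 -> (2 <= n)%nat -> a ^ n <= a ^ 2.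
Proof.
intros Ha Hn; replace n with (2 + (n - 2))%nat by lia; rewrite pow_add.
rewrite <- (Rmult_1_r (a ^ 2)) at 2; apply Rmult_le_compat_l; [apply pow2_ge_0|].
rewrite <- (pow1 (n - 2)); apply pow_incr; lra.
Qed.

Lemma bounded_lip_frequency (Phi : R -> R) (l1 : R) :
  smooth1 Phi ->
  (exists K d, 0 < d /\ forall s, Rabs s < d -> Rabs (Phi s - l1 * s) <= K * s ^ 2) ->
  exists K d, 0 < d /\ forall a, 0 < a < d ->
    bounded_lip (K * a ^ 4) (fun r _ => Phi ((a * r) ^ 2) - l1 * (a * r) ^ 2).
Proof.
intros HPhi HPhi0.
destruct (frequency_derivative_bound Phi l1 HPhi HPhi0) as [M [d [HM [Hd H]]]].
(* The argument (a r)^2 is at most 4 a^2, whose square gives 16 a^4; a < 1 and a < d/4 put 4 a^2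
   below [d]. *)
exists (M * 16), (Rmin 1 (d / 4)); split; [apply Rmin_glb_lt; lra|].
intros a Ha; assert (Ha1 := Rmin_l 1 (d / 4)); assert (Ha2 := Rmin_r 1 (d / 4)).
intros r t r' t' Hr Hr'.
assert (Ha4 : 0 < a ^ 4) by (apply pow_lt; lra).
assert (Hh : 0 < 4 * a ^ 2 < d).
{ assert (a ^ 2 <= a) by nra.
  assert (0 < a ^ 2) by (apply pow_lt; lra); lra. }
assert (Hs : forall u, 1 / 2 <= u <= 2 -> 0 <= (a * u) ^ 2 <= 4 * a ^ 2).
{ intros u Hu; split; [apply pow2_ge_0|].
  replace (4 * a ^ 2) with ((a * 2) ^ 2) by ring.
  apply pow_incr; split; [apply Rmult_le_pos; lra|apply Rmult_le_compat_l; lra]. }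
assert (S0 := Hs r Hr); assert (S1 := Hs r' Hr').
split.
- eapply Rle_trans; [apply (H (4 * a ^ 2)); [lra|apply Rabs_le; lra]|].
  right; ring.
- eapply Rle_trans.
  + apply (lipschitz_of_derive (fun s => Phi s - l1 * s) 0 (4 * a ^ 2) (M * (4 * a ^ 2)));
      [|assumption|assumption].
    intros s Hs'; split.
    * apply (ex_derive_minus Phi (fun s => l1 * s)); [exact (HPhi 1%nat s)|].
      auto_derive; trivial.
    * rewrite Derive_minus, Derive_scal, Derive_id.
      2: exact (HPhi 1%nat s).
      2: auto_derive; trivial.
      rewrite Rmult_1_r; apply (H (4 * a ^ 2)); [lra|apply Rabs_le; lra].
  + replace ((a * r) ^ 2 - (a * r') ^ 2) with (a ^ 2 * ((r + r') * (r - r'))) by ring.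
    rewrite !Rabs_mult, (Rabs_pos_eq (a ^ 2)), (Rabs_pos_eq (r + r')) by (try apply pow2_ge_0; lra).
    assert (P := Rabs_pos (r - r')); assert (Q := Rabs_pos (t - t')).
    replace (M * (4 * a ^ 2) * (a ^ 2 * ((r + r') * Rabs (r - r'))))
      with (4 * (M * a ^ 4) * ((r + r') * Rabs (r - r'))) by ring.
    replace (M * 16 * a ^ 4 * (Rabs (r - r') + Rabs (t - t')))
      with (4 * (M * a ^ 4) * (4 * (Rabs (r - r') + Rabs (t - t')))) by ring.
    apply Rmult_le_compat_l.
    * apply Rmult_le_pos; [lra|]; apply Rmult_le_pos; lra.
    * apply Rmult_le_compat; lra.
Qed.

(* With z = a r e^(it) and w = j + 4 = 2 q, the equilibrium equations become
   m + l1 a^2 (r^2 + radial_error) = 0 and sin (w t) + angular_error = 0. *)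
Definition radial_error (l1 alpha w : R) (j : nat) (Phi : R -> R)
  (g1 g2 : R -> R -> R -> R) (a m r t : R) : R :=
  (Phi ((a * r) ^ 2) - l1 * (a * r) ^ 2) * / (l1 * a ^ 2)
  + r ^ (j + 2) * cos (w * t) * (alpha / l1 * a ^ j)
  + (cos t * g2 (a * r * cos t) (a * r * sin t) m
     + sin t * g1 (a * r * cos t) (a * r * sin t) m * -1) * / r * / (l1 * a ^ 3).

Definition angular_error (alpha : R) (j : nat)
  (g1 g2 : R -> R -> R -> R) (a m r t : R) : R :=
  (cos t * g1 (a * r * cos t) (a * r * sin t) m
   + sin t * g2 (a * r * cos t) (a * r * sin t) m) * (/ r) ^ (j + 3)
  * / (alpha * a ^ (j + 3)).

(** Counting powers of [a]: the frequency error has a^4 / a^2, the resonant term a^j, the remainder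
    a^(j+5) / a^3 in the radial and a^(j+5) / a^(j+3) in the angular equation. All are O(a^2) once j
    >= 2, which is the condition q >= 3. *)
Lemma error_bounds (l1 alpha w K d : R) (j : nat) (Phi : R -> R) (g1 g2 : R -> R -> R -> R) :
  (2 <= j)%nat -> l1 <> 0 -> alpha <> 0 -> smooth1 Phi ->
  (exists K d, 0 < d /\ forall s, Rabs s < d -> Rabs (Phi s - l1 * s) <= K * s ^ 2) ->
  smooth3 g1 -> smooth3 g2 -> 0 < d ->
  (forall h x y m, 0 < h < d -> Rabs x <= h -> Rabs y <= h -> Rabs m < d ->
     Rabs (g1 x y m) <= K * h ^ (j + 5) /\ Rabs (g2 x y m) <= K * h ^ (j + 5)) ->
  exists K' d', 0 < d' /\ forall a m, 0 < a < d' -> Rabs m < d' ->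
    bounded_lip (K' * a ^ 2) (radial_error l1 alpha w j Phi g1 g2 a m) /\
    bounded_lip (K' * a ^ 2) (angular_error alpha j g1 g2 a m).
Proof.
intros Hj Hl Hal HPhi HPhi0 Hg1 Hg2 Hd Hflat.
replace (j + 5)%nat with (S (S (j + 3))) in Hflat by lia.
destruct (bounded_lip_frequency Phi l1 HPhi HPhi0) as [K0 [d0 [Hd0 B0]]].
destruct (bounded_lip_polar (j + 3) g1 K d Hg1 Hd) as [K1 [d1 [Hd1 B1]]].
{ intros; apply Hflat; assumption. }
destruct (bounded_lip_polar (j + 3) g2 K d Hg2 Hd) as [K2 [d2 [Hd2 B2]]].
{ intros; apply Hflat; assumption. }
destruct (bounded_lip_pow _ _ (j + 2) bounded_lip_radius) as [K3 B3].
destruct (bounded_lip_pow _ _ (j + 3) bounded_lip_inv_radius) as [K4 B4].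
assert (K4p := bounded_lip_pos _ _ B4).
set (B5 := bounded_lip_mult _ _ _ _ B3 (bounded_lip_cos_mult w)).
set (K5 := 2 * (K3 * (1 + Rabs w))) in *.
assert (K5p := bounded_lip_pos _ _ B5).
set (D := Rmin (Rmin 1 d0) (Rmin d1 d2)).
assert (HD : 0 < D) by (repeat apply Rmin_glb_lt; lra).
assert (D1 : D <= 1) by (unfold D; eapply Rle_trans; apply Rmin_l).
assert (D2 : D <= d0) by (unfold D; eapply Rle_trans; [apply Rmin_l|apply Rmin_r]).
assert (D3 : D <= d1) by (unfold D; eapply Rle_trans; [apply Rmin_r|apply Rmin_l]).
assert (D4 : D <= d2) by (unfold D; eapply Rle_trans; apply Rmin_r).
set (Kr := Rabs (/ l1) * K0 + Rabs (alpha / l1) * K5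
           + Rabs (/ l1) * (2 * ((2 * (1 * K2) + 2 * (1 * K1)) * 4))).
set (Ka := Rabs (/ alpha) * (2 * ((2 * (1 * K1) + 2 * (1 * K2)) * K4))).
exists (Rabs Kr + Rabs Ka), D; split; [exact HD|].
intros a m Ha Hm.
assert (Ha2 : 0 < a ^ 2) by (apply pow_lt; lra).
assert (Ha5 : 0 < a ^ (S (S (j + 3)))) by (apply pow_lt; lra).
assert (b0 := B0 a ltac:(lra)).
assert (b1 := B1 a m ltac:(lra) ltac:(lra)).
assert (b2 := B2 a m ltac:(lra) ltac:(lra)).
assert (Kpos : forall k, 0 <= k * a ^ S (S (j + 3)) -> 0 <= k).
{ intros k Hk; apply (Rmult_le_reg_r (a ^ S (S (j + 3)))); lra. }
assert (p0 : 0 <= K0).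
{ apply (Rmult_le_reg_r (a ^ 4)); [apply pow_lt; lra|].
  rewrite Rmult_0_l; exact (bounded_lip_pos _ _ b0). }
assert (p1 := Kpos _ (bounded_lip_pos _ _ b1)).
assert (p2 := Kpos _ (bounded_lip_pos _ _ b2)).
assert (Hpow : forall k, (2 <= k)%nat -> a ^ k <= a ^ 2).
{ intros k Hk; apply pow_le_square; [lra|exact Hk]. }
split.
- apply (bounded_lip_weaken (Kr * a ^ 2)).
  { apply Rmult_le_compat_r; [lra|].
    assert (H := Rle_abs Kr); assert (H' := Rabs_pos Ka); lra. }
  eapply bounded_lip_weaken.
  2: { unfold radial_error; apply bounded_lip_plus; [apply bounded_lip_plus|].
       - apply bounded_lip_scal, b0.
       - apply bounded_lip_scal, B5.
       - apply bounded_lip_scal, bounded_lip_mult; [|exact bounded_lip_inv_radius].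
         apply bounded_lip_plus.
         + exact (bounded_lip_mult _ _ _ _ bounded_lip_cos b2).
         + apply bounded_lip_scal.
           exact (bounded_lip_mult _ _ _ _ bounded_lip_sin b1). }
  unfold Kr; match goal with |- _ <= (?x + ?y + ?z) * ?u =>
    replace ((x + y + z) * u) with (x * u + y * u + z * u) by ring end.
  apply Rplus_le_compat; [apply Rplus_le_compat|].
  + rewrite Rinv_mult, Rabs_mult, (Rabs_pos_eq (/ a ^ 2)).
    2: left; apply Rinv_0_lt_compat; exact Ha2.
    right; field; lra.
  + rewrite Rabs_mult, (Rabs_pos_eq (a ^ j)) by (apply pow_le; lra).
    rewrite (Rmult_assoc _ K5), (Rmult_comm K5), <- !Rmult_assoc.
    apply Rmult_le_compat_r; [exact K5p|].
    apply Rmult_le_compat_l; [apply Rabs_pos|]; apply Hpow, Hj.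
  + rewrite Rinv_mult, Rabs_mult, (Rabs_pos_eq (/ a ^ 3)).
    2: left; apply Rinv_0_lt_compat, pow_lt; lra.
    replace (Rabs (-1)) with 1 by (rewrite Rabs_left; lra).
    replace (S (S (j + 3)))%nat with (3 + (j + 2))%nat by lia; rewrite (pow_add a 3).
    apply Rle_trans with
      (Rabs (/ l1) * (2 * ((2 * (1 * K2) + 2 * (1 * K1)) * 4)) * a ^ (j + 2)).
    * right; field; lra.
    * apply Rmult_le_compat_l; [|apply Hpow; lia].
      apply Rmult_le_pos; [apply Rabs_pos|lra].
- apply (bounded_lip_weaken (Ka * a ^ 2)).
  { apply Rmult_le_compat_r; [lra|].
    assert (H := Rle_abs Ka); assert (H' := Rabs_pos Kr); lra. }
  eapply bounded_lip_weaken.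
  2: { unfold angular_error.
       apply bounded_lip_scal, bounded_lip_mult; [|exact B4].
       apply bounded_lip_plus.
       - exact (bounded_lip_mult _ _ _ _ bounded_lip_cos b1).
       - exact (bounded_lip_mult _ _ _ _ bounded_lip_sin b2). }
  assert (Hj3 : 0 < a ^ (j + 3)) by (apply pow_lt; lra).
  rewrite Rinv_mult, Rabs_mult, (Rabs_pos_eq (/ a ^ (j + 3))).
  2: left; apply Rinv_0_lt_compat; exact Hj3.
  right; unfold Ka.
  replace (S (S (j + 3)))%nat with (2 + (j + 3))%nat by lia; rewrite (pow_add a 2).
  field; lra.
Qed.

(** * The vector field and its linearization *)

Definition Rre (Rf : C -> R -> C) (x y m : R) : R := fst (Rf (x, y) m).
Definition Rim (Rf : C -> R -> C) (x y m : R) : R := snd (Rf (x, y) m).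

Lemma garland_components (q : nat) (alpha : R) (Phi : R -> R) (Rf : C -> R -> C) (mu x y : R) :
  garland_field q alpha Phi Rf mu (x, y) =
  (- (mu + Phi (x ^ 2 + y ^ 2)) * y - alpha * snd (Cpow (x, - y) (2 * q - 1)) + Rre Rf x y mu,
   (mu + Phi (x ^ 2 + y ^ 2)) * x + alpha * fst (Cpow (x, - y) (2 * q - 1)) + Rim Rf x y mu).
Proof.
unfold garland_field, Rre, Rim, Cconj; cbn [fst snd].
replace (Cmod (x, y) ^ 2) with (x ^ 2 + y ^ 2).
2: { unfold Cmod; cbn [fst snd]; rewrite pow2_sqrt; [reflexivity|].
     apply Rplus_le_le_0_compat; apply pow2_ge_0. }
destruct (Cpow (x, - y) (2 * q - 1)) as [w1 w2]; destruct (Rf (x, y) mu) as [r1 r2].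
unfold Cplus, Cmult, Ci, RtoC; cbn [fst snd]; f_equal; ring.
Qed.

Lemma Cpow_conj_polar (r t : R) (n : nat) :
  Cpow (r * cos t, - (r * sin t)) n = (r ^ n * cos (INR n * t), - (r ^ n * sin (INR n * t))).
Proof.
induction n as [|n IH].
- simpl; rewrite Rmult_0_l, cos_0, sin_0; unfold RtoC; f_equal; ring.
- rewrite Cpow_S, IH, S_INR, Rmult_plus_distr_r, Rmult_1_l, cos_plus, sin_plus.
  unfold Cmult; simpl; f_equal; ring.
Qed.

Lemma Cpow_conj_derive_x (x y : R) (n : nat) :
  is_derive (fun t => fst (Cpow (x + t, - y) n)) 0 (INR n * fst (Cpow (x, - y) (pred n))) /\
  is_derive (fun t => snd (Cpow (x + t, - y) n)) 0 (INR n * snd (Cpow (x, - y) (pred n))).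
Proof.
induction n as [|n [IH1 IH2]].
- simpl; rewrite !Rmult_0_l; split; apply (is_derive_const (V := R_NormedModule)).
- set (f1 := fun t => fst (Cpow (x + t, - y) n)) in *.
  set (f2 := fun t => snd (Cpow (x + t, - y) n)) in *.
  assert (E0 : Cpow (x, - y) n = (f1 0, f2 0)).
  { unfold f1, f2; rewrite Rplus_0_r; apply surjective_pairing. }
  (* The factor [INR n] keeps the recursion true at n = 0, where [pred n] is again 0. *)
  assert (E1 : INR n * fst (Cpow (x, - y) n) =
               INR n * (x * fst (Cpow (x, - y) (pred n)) + y * snd (Cpow (x, - y) (pred n)))).
  { destruct n as [|n]; [simpl; ring|]; cbn [pred]; rewrite Cpow_S.
    unfold Cmult; simpl; ring. }
  assert (E2 : INR n * snd (Cpow (x, - y) n) =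
               INR n * (x * snd (Cpow (x, - y) (pred n)) - y * fst (Cpow (x, - y) (pred n)))).
  { destruct n as [|n]; [simpl; ring|]; cbn [pred]; rewrite Cpow_S.
    unfold Cmult; simpl; ring. }
  rewrite S_INR; cbn [pred].
  rewrite !Rmult_plus_distr_r, E1, E2, E0; simpl fst; simpl snd; split.
  + apply (is_derive_ext (fun t => (x + t) * f1 t + y * f2 t)).
    { intros t; unfold f1, f2; simpl; ring. }
    auto_derive; [repeat split; eexists; eassumption|].
    change (fun x0 : R => f1 x0) with f1; change (fun x0 : R => f2 x0) with f2.
    rewrite (is_derive_unique f1 _ _ IH1), (is_derive_unique f2 _ _ IH2); ring.
  + apply (is_derive_ext (fun t => (x + t) * f2 t - y * f1 t)).
    { intros t; unfold f1, f2; simpl; ring. }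
    auto_derive; [repeat split; eexists; eassumption|].
    change (fun x0 : R => f1 x0) with f1; change (fun x0 : R => f2 x0) with f2.
    rewrite (is_derive_unique f1 _ _ IH1), (is_derive_unique f2 _ _ IH2); ring.
Qed.

(** The derivative of (z^* )^n in [y] is - i n (z^* )^(n-1); multiplication by - i exchanges the
    components and changes one sign. *)
Lemma Cpow_conj_derive_y (x y : R) (n : nat) :
  is_derive (fun t => fst (Cpow (x, - (y + t)) n)) 0 (INR n * snd (Cpow (x, - y) (pred n))) /\
  is_derive (fun t => snd (Cpow (x, - (y + t)) n)) 0 (- (INR n * fst (Cpow (x, - y) (pred n)))).
Proof.
induction n as [|n [IH1 IH2]].
- simpl; rewrite !Rmult_0_l, Ropp_0; split; apply (is_derive_const (V := R_NormedModule)).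
- set (f1 := fun t => fst (Cpow (x, - (y + t)) n)) in *.
  set (f2 := fun t => snd (Cpow (x, - (y + t)) n)) in *.
  assert (E0 : Cpow (x, - y) n = (f1 0, f2 0)).
  { unfold f1, f2; rewrite Rplus_0_r; apply surjective_pairing. }
  assert (E1 : INR n * fst (Cpow (x, - y) n) =
               INR n * (x * fst (Cpow (x, - y) (pred n)) + y * snd (Cpow (x, - y) (pred n)))).
  { destruct n as [|n]; [simpl; ring|]; cbn [pred]; rewrite Cpow_S.
    unfold Cmult; simpl; ring. }
  assert (E2 : INR n * snd (Cpow (x, - y) n) =
               INR n * (x * snd (Cpow (x, - y) (pred n)) - y * fst (Cpow (x, - y) (pred n)))).
  { destruct n as [|n]; [simpl; ring|]; cbn [pred]; rewrite Cpow_S.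
    unfold Cmult; simpl; ring. }
  rewrite S_INR; cbn [pred].
  rewrite !Rmult_plus_distr_r, E1, E2, E0; simpl fst; simpl snd; split.
  + apply (is_derive_ext (fun t => x * f1 t + (y + t) * f2 t)).
    { intros t; unfold f1, f2; simpl; ring. }
    auto_derive; [repeat split; eexists; eassumption|].
    change (fun x0 : R => f1 x0) with f1; change (fun x0 : R => f2 x0) with f2.
    rewrite (is_derive_unique f1 _ _ IH1), (is_derive_unique f2 _ _ IH2); ring.
  + apply (is_derive_ext (fun t => x * f2 t - (y + t) * f1 t)).
    { intros t; unfold f1, f2; simpl; ring. }
    auto_derive; [repeat split; eexists; eassumption|].
    change (fun x0 : R => f1 x0) with f1; change (fun x0 : R => f2 x0) with f2.
    rewrite (is_derive_unique f1 _ _ IH1), (is_derive_unique f2 _ _ IH2); ring.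
Qed.

(** A function holomorphic in z^* has a symmetric traceless Jacobian, which is why each of [b1] and
    [b2] occurs twice. The terms with [p] form the rank-one matrix 2 p (- y, x) (x, y)^T, and [m]
    contributes a rotation. *)
Lemma garland_jacobian (q : nat) (alpha : R) (Phi : R -> R) (Rf : C -> R -> C) (mu x y : R) :
  smooth1 Phi -> smoothC3 Rf ->
  let F := garland_field q alpha Phi Rf mu in
  let m := mu + Phi (x ^ 2 + y ^ 2) in
  let p := Derive Phi (x ^ 2 + y ^ 2) in
  let b1 := alpha * (INR (2 * q - 1) * fst (Cpow (x, - y) (pred (2 * q - 1)))) in
  let b2 := alpha * (INR (2 * q - 1) * snd (Cpow (x, - y) (pred (2 * q - 1)))) in
  has_partials F (x, y) /\
  jac_a F (x, y) = - (2 * x * y * p) - b2 + partial3 0 (Rre Rf) x y mu /\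
  jac_b F (x, y) = - m - 2 * y ^ 2 * p + b1 + partial3 1 (Rre Rf) x y mu /\
  jac_c F (x, y) = m + 2 * x ^ 2 * p + b1 + partial3 0 (Rim Rf) x y mu /\
  jac_d F (x, y) = 2 * x * y * p + b2 + partial3 1 (Rim Rf) x y mu.
Proof.
intros HPhi [HR1 HR2] F m p b1 b2.
change (smooth3 (Rre Rf)) in HR1; change (smooth3 (Rim Rf)) in HR2.
assert (dPhi : ex_derive Phi (x ^ 2 + y ^ 2)) by exact (HPhi 1%nat _).
destruct (Cpow_conj_derive_x x y (2 * q - 1)) as [X1 X2].
destruct (Cpow_conj_derive_y x y (2 * q - 1)) as [Y1 Y2].
assert (Gd : forall g i, smooth3 g -> (i < 3)%nat ->
               is_derive (dir3 i g x y mu) 0 (partial3 i g x y mu)).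
{ intros g i Hg Hi; apply Derive_correct; apply (ex_derive_dir3 nil); assumption. }
assert (Ex : x + 0 = x) by ring; assert (Ey : y + 0 = y) by ring.
assert (Ja : is_derive (fun t => reF F (x + t, y)) 0
               (- (2 * x * y * p) - b2 + partial3 0 (Rre Rf) x y mu)).
(* Naming the power and the remainder lets [auto_derive] treat them as opaque functions, whose
   derivatives are [X2] and [G]. *)
{ set (w := fun t => snd (Cpow (x + t, - y) (2 * q - 1))) in *.
  assert (G := Gd (Rre Rf) 0%nat HR1 ltac:(lia)).
  set (g := dir3 0 (Rre Rf) x y mu) in *.
  apply (is_derive_ext (fun t => - (mu + Phi ((x + t) ^ 2 + y ^ 2)) * y - alpha * w t + g t)).
  { intros t; unfold reF, F; rewrite garland_components; reflexivity. }
  auto_derive.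
  - rewrite Ex; repeat split; try assumption; eexists; eassumption.
  - change (fun x0 : R => w x0) with w; change (fun x0 : R => g x0) with g.
    rewrite (is_derive_unique w _ _ X2), (is_derive_unique g _ _ G), Ex.
    unfold p, b2; change (Derive (fun x0 => Phi x0)) with (Derive Phi); simpl; ring. }
assert (Jb : is_derive (fun t => reF F (x, y + t)) 0
               (- m - 2 * y ^ 2 * p + b1 + partial3 1 (Rre Rf) x y mu)).
{ set (w := fun t => snd (Cpow (x, - (y + t)) (2 * q - 1))) in *.
  assert (G := Gd (Rre Rf) 1%nat HR1 ltac:(lia)).
  set (g := dir3 1 (Rre Rf) x y mu) in *.
  apply (is_derive_ext
    (fun t => - (mu + Phi (x ^ 2 + (y + t) ^ 2)) * (y + t) - alpha * w t + g t)).
  { intros t; unfold reF, F; rewrite garland_components; reflexivity. }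
  auto_derive.
  - rewrite Ey; repeat split; try assumption; eexists; eassumption.
  - change (fun x0 : R => w x0) with w; change (fun x0 : R => g x0) with g.
    rewrite (is_derive_unique w _ _ Y2), (is_derive_unique g _ _ G), Ey.
    unfold m, p, b1; change (Derive (fun x0 => Phi x0)) with (Derive Phi); simpl; ring. }
assert (Jc : is_derive (fun t => imF F (x + t, y)) 0
               (m + 2 * x ^ 2 * p + b1 + partial3 0 (Rim Rf) x y mu)).
{ set (w := fun t => fst (Cpow (x + t, - y) (2 * q - 1))) in *.
  assert (G := Gd (Rim Rf) 0%nat HR2 ltac:(lia)).
  set (g := dir3 0 (Rim Rf) x y mu) in *.
  apply (is_derive_ext
    (fun t => (mu + Phi ((x + t) ^ 2 + y ^ 2)) * (x + t) + alpha * w t + g t)).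
  { intros t; unfold imF, F; rewrite garland_components; reflexivity. }
  auto_derive.
  - rewrite Ex; repeat split; try assumption; eexists; eassumption.
  - change (fun x0 : R => w x0) with w; change (fun x0 : R => g x0) with g.
    rewrite (is_derive_unique w _ _ X1), (is_derive_unique g _ _ G), Ex.
    unfold m, p, b1; change (Derive (fun x0 => Phi x0)) with (Derive Phi); simpl; ring. }
assert (Jd : is_derive (fun t => imF F (x, y + t)) 0
               (2 * x * y * p + b2 + partial3 1 (Rim Rf) x y mu)).
{ set (w := fun t => fst (Cpow (x, - (y + t)) (2 * q - 1))) in *.
  assert (G := Gd (Rim Rf) 1%nat HR2 ltac:(lia)).
  set (g := dir3 1 (Rim Rf) x y mu) in *.
  apply (is_derive_ext
    (fun t => (mu + Phi (x ^ 2 + (y + t) ^ 2)) * x + alpha * w t + g t)).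
  { intros t; unfold imF, F; rewrite garland_components; reflexivity. }
  auto_derive.
  - rewrite Ey; repeat split; try assumption; eexists; eassumption.
  - change (fun x0 : R => w x0) with w; change (fun x0 : R => g x0) with g.
    rewrite (is_derive_unique w _ _ Y1), (is_derive_unique g _ _ G), Ey.
    unfold p, b2; change (Derive (fun x0 => Phi x0)) with (Derive Phi); simpl; ring. }
split; [|split; [|split; [|split]]].
- repeat split; simpl; eexists; eassumption.
- exact (is_derive_unique _ _ _ Ja).
- exact (is_derive_unique _ _ _ Jb).
- exact (is_derive_unique _ _ _ Jc).
- exact (is_derive_unique _ _ _ Jd).
Qed.

(** Multiplication of the field by e^(-it) separates the effects: the tangential component contains
    the frequency and determines [r], the radial one contains the sine and determines [t]. Each is
    divided by its own nonzero leading factor, a r or alpha (a r)^(2q-1). *)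
Lemma polar_equilibrium (q j : nat) (l1 alpha : R) (Phi : R -> R) (Rf : C -> R -> C)
  (mu a r t : R) :
  (2 * q = j + 4)%nat -> l1 <> 0 -> alpha <> 0 -> 0 < a -> 0 < r ->
  is_equilibrium (garland_field q alpha Phi Rf mu) (a * r * cos t, a * r * sin t) <->
  mu + l1 * a ^ 2 * (r ^ 2 + radial_error l1 alpha (2 * INR q) j Phi (Rre Rf) (Rim Rf) a mu r t) = 0 /\
  sin (2 * INR q * t) + angular_error alpha j (Rre Rf) (Rim Rf) a mu r t = 0.
Proof.
intros Hq Hl Hal Ha Hr; unfold is_equilibrium; rewrite garland_components.
replace (2 * q - 1)%nat with (j + 3)%nat by lia.
rewrite Cpow_conj_polar; cbn [fst snd].
assert (Htrig := sin2_cos2 t); unfold Rsqr in Htrig.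
replace ((a * r * cos t) ^ 2 + (a * r * sin t) ^ 2) with ((a * r) ^ 2).
2: { transitivity ((a * r) ^ 2 * (sin t * sin t + cos t * cos t)); [rewrite Htrig|]; ring. }
assert (Hang : 2 * INR q * t = INR (j + 3) * t + t).
{ replace (2 * INR q) with (INR (j + 4)).
  - rewrite !plus_INR; simpl; ring.
  - rewrite <- Hq, mult_INR; reflexivity. }
set (X := - (mu + Phi ((a * r) ^ 2)) * (a * r * sin t) - _ + _).
set (Y := (mu + Phi ((a * r) ^ 2)) * (a * r * cos t) + _ + _).
assert (Har : 0 < a * r) by (apply Rmult_lt_0_compat; assumption).
assert (Ha3 : 0 < (a * r) ^ (j + 3)) by (apply pow_lt; exact Har).
assert (Haj : 0 < a ^ (j + 3)) by (apply pow_lt; exact Ha).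
assert (Hrj : 0 < r ^ (j + 3)) by (apply pow_lt; exact Hr).
(* [E1] is the radial and [E2] the tangential component; the inverse rotation recovers [X] and [Y]
   for the converse. *)
assert (E1 : cos t * X + sin t * Y = alpha * (a * r) ^ (j + 3) *
   (sin (2 * INR q * t) + angular_error alpha j (Rre Rf) (Rim Rf) a mu r t)).
{ unfold angular_error, X, Y; rewrite Hang, sin_plus, pow_inv, (Rpow_mult_distr a r (j + 3)).
  field; lra. }
assert (E2 : cos t * Y - sin t * X = a * r * (mu + l1 * a ^ 2 *
   (r ^ 2 + radial_error l1 alpha (2 * INR q) j Phi (Rre Rf) (Rim Rf) a mu r t))).
{ transitivity (a * r * (mu + Phi ((a * r) ^ 2)) * (sin t * sin t + cos t * cos t)
      + alpha * (a * r) ^ (j + 3) * (cos t * cos (INR (j + 3) * t) - sin t * sin (INR (j + 3) * t))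
      + (cos t * Rim Rf (a * r * cos t) (a * r * sin t) mu
         - sin t * Rre Rf (a * r * cos t) (a * r * sin t) mu)).
  { unfold X, Y; ring. }
  unfold radial_error; rewrite Htrig, Hang, cos_plus, (Rpow_mult_distr a r (j + 3)).
  replace (j + 3)%nat with (S (j + 2)) by lia.
  replace (a ^ S (j + 2)) with (a ^ 3 * a ^ j) by (rewrite <- pow_add; f_equal; lia).
  rewrite <- (tech_pow_Rmult r); field; lra. }
split.
- intros H; injection H as HX HY; rewrite HX, HY in E1, E2.
  split.
  + apply (Rmult_eq_reg_l (a * r)); [rewrite <- E2; ring|lra].
  + apply (Rmult_eq_reg_l (alpha * (a * r) ^ (j + 3))); [rewrite <- E1; ring|].
    apply Rmult_integral_contrapositive; lra.
- intros [H1 H2]; rewrite H1 in E2; rewrite H2 in E1.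
  unfold RtoC; f_equal.
  + transitivity (cos t * (cos t * X + sin t * Y) - sin t * (cos t * Y - sin t * X)).
    * transitivity ((sin t * sin t + cos t * cos t) * X); [rewrite Htrig|]; ring.
    * rewrite E1, E2; ring.
  + transitivity (sin t * (cos t * X + sin t * Y) + cos t * (cos t * Y - sin t * X)).
    * transitivity ((sin t * sin t + cos t * cos t) * Y); [rewrite Htrig|]; ring.
    * rewrite E1, E2; ring.
Qed.

(** * The type of an equilibrium read off its determinant *)

Definition jac_det (F : C -> C) (z : C) : R := jac_a F z * jac_d F z - jac_b F z * jac_c F z.

(** With zero trace the characteristic equation is lam^2 + det = 0; its imaginary part 2 u v forces
    eigenvalues onto one of the axes, and the sign of the determinant chooses which. *)
Lemma traceless_eigenvalue (F : C -> C) (z : C) (u v : R) :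
  divergence F z = 0 ->
  is_eigenvalue F z (u, v) <-> u ^ 2 - v ^ 2 + jac_det F z = 0 /\ u * v = 0.
Proof.
intros Hdiv; change (jac_a F z + jac_d F z = 0) in Hdiv.
unfold is_eigenvalue, jac_det.
replace (jac_d F z) with (- jac_a F z) by lra.
generalize (jac_a F z) (jac_b F z) (jac_c F z); intros a b c.
unfold Cminus, Cplus, Copp, Cmult, RtoC; cbn [fst snd]; split.
- intros H; injection H as H1 H2; split; [rewrite <- H1; ring|].
  apply (Rmult_eq_reg_l 2); [|lra]; rewrite Rmult_0_r, <- H2; ring.
- intros [H1 H2]; f_equal.
  + transitivity (u ^ 2 - v ^ 2 + (a * - a - b * c)); [ring|exact H1].
  + transitivity (2 * (u * v)); [ring|rewrite H2; ring].
Qed.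

Lemma center_of_det_pos (F : C -> C) (z : C) :
  is_equilibrium F z -> has_partials F z -> divergence F z = 0 -> 0 < jac_det F z ->
  is_center F z.
Proof.
intros Heq Hp Hdiv Hd; split; [exact Heq|split].
- split; [exact Hp|]; fold (jac_det F z); lra.
- intros [u v] H; apply (traceless_eigenvalue F z u v Hdiv) in H; destruct H as [H1 H2].
  assert (Hu : u = 0).
  { destruct (Rmult_integral _ _ H2) as [H|H]; [exact H|].
    subst v; assert (H := pow2_ge_0 u); lra. }
  split; [exact Hu|]; intros H; injection H as _ Hv.
  subst; lra.
Qed.

Lemma saddle_of_det_neg (F : C -> C) (z : C) :
  is_equilibrium F z -> has_partials F z -> divergence F z = 0 -> jac_det F z < 0 ->
  is_saddle F z.
Proof.
intros Heq Hp Hdiv Hd; split; [exact Heq|split; [|split]].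
- split; [exact Hp|]; fold (jac_det F z); lra.
- intros [u v] H; apply (traceless_eigenvalue F z u v Hdiv) in H; destruct H as [H1 H2].
  destruct (Rmult_integral _ _ H2) as [H|H]; [|exact H].
  subst u; assert (H := pow2_ge_0 v); lra.
- set (s := sqrt (- jac_det F z)).
  assert (Hs : 0 < s) by (apply sqrt_lt_R0; lra).
  assert (Hs2 : s ^ 2 = - jac_det F z) by (apply pow2_sqrt; lra).
  exists (- s), s; split; [lra|]; split; apply (traceless_eigenvalue F z _ _ Hdiv).
  + split; [replace ((- s) ^ 2) with (s ^ 2) by ring; rewrite Hs2|]; ring.
  + split; [rewrite Hs2|]; ring.
Qed.

(** * Sign of the determinant at a nonzero equilibrium *)

Lemma Rabs_plus_bound (x y a b : R) : Rabs x <= a -> Rabs y <= b -> Rabs (x + y) <= a + b.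
Proof. intros Hx Hy; eapply Rle_trans; [apply Rabs_triang|]; lra. Qed.

Lemma Rabs_minus_bound (x y a b : R) : Rabs x <= a -> Rabs y <= b -> Rabs (x - y) <= a + b.
Proof. intros Hx Hy; apply Rabs_plus_bound; [exact Hx|]; now rewrite Rabs_Ropp. Qed.

Lemma Rabs_mult_bound (x y a b : R) : Rabs x <= a -> Rabs y <= b -> Rabs (x * y) <= a * b.
Proof. intros Hx Hy; rewrite Rabs_mult; apply Rmult_le_compat; auto using Rabs_pos. Qed.

(* In the application s = r^2, k = r^(2q-6), w = r^(2q-4) = s k, and the four factors are
   the Jacobian entries divided by r^2; co and si are cos t and sin t, cn and sn are
   cos ((2q-2) t) and sin ((2q-2) t), and e stands for cos (2 q t). *)
Lemma determinant_expansion (l1 alpha n B : R) :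
  exists K, forall co si cn sn s k p0 nu ra rb rc rd,
    Rabs co <= B -> Rabs si <= B -> Rabs cn <= B -> Rabs sn <= B ->
    Rabs s <= B -> Rabs k <= B -> Rabs p0 <= B -> Rabs nu <= B ->
    Rabs ra <= B -> Rabs rb <= B -> Rabs rc <= B -> Rabs rd <= B ->
    si * si + co * co = 1 -> sn * sn + cn * cn = 1 ->
    let w := s * k in
    let p := l1 + s * p0 in
    let e := (co * co - si * si) * cn - 2 * si * co * sn in
    let m := - alpha * e - s * nu in
    exists X, Rabs X <= K /\
      (- (2 * co * si * p) + alpha * n * w * sn + s * w * ra)
      * (2 * co * si * p - alpha * n * w * sn + s * w * rd)
      - (- (w * m) - 2 * si * si * p + alpha * n * w * cn + s * w * rb)
        * (w * m + 2 * co * co * p + alpha * n * w * cn + s * w * rc)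
      = w * (- (2 * (n + 1) * l1 * alpha * e) + s * X).
Proof.
(* [K] stays open here; the bound is assembled later by unification, following the shape of the
   witness for [X]. *)
eexists; intros co si cn sn s k p0 nu ra rb rc rd.
intros Hco Hsi Hcn Hsn Hs Hk Hp Hnu Hra Hrb Hrc Hrd H1 H2; cbv zeta.
set (e := (co * co - si * si) * cn - 2 * si * co * sn).
(* The terms 4 co^2 si^2 p^2 cancel. At order [w] there remain 2 m p, from the rotation, and - 2 n
   alpha p e, from the resonant term; with m = - alpha e - s nu they yield the factor n + 1. The
   witness is everything else divided by s w. *)
exists (- (2 * (n + 1) * p0 * alpha * e) - 2 * (l1 + s * p0) * nu
  + k * ((- alpha * e - s * nu) * (- alpha * e - s * nu) - alpha * alpha * (n * n))
  + ((- (2 * co * si * (l1 + s * p0)) + alpha * n * (s * k) * sn) * rd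
     + (2 * co * si * (l1 + s * p0) - alpha * n * (s * k) * sn) * ra
     - (- (s * k * (- alpha * e - s * nu)) - 2 * si * si * (l1 + s * p0)
        + alpha * n * (s * k) * cn) * rc
     - (s * k * (- alpha * e - s * nu) + 2 * co * co * (l1 + s * p0)
        + alpha * n * (s * k) * cn) * rb)
  + s * (s * k) * (ra * rd - rb * rc)).
split.
- unfold e.
  repeat first [eassumption | apply Rabs_plus_bound | apply Rabs_minus_bound
               | apply Rabs_mult_bound | rewrite Rabs_Ropp | apply Rle_refl].
- assert (E1 : co * co = 1 - si * si) by lra.
  assert (E2 : cn * cn = 1 - sn * sn) by lra.
  unfold e; ring [E1 E2].
Qed.

Lemma Rabs_div_le (x K y : R) : 0 < y -> Rabs x <= K * y -> Rabs (x / y) <= K.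
Proof.
intros Hy H; rewrite Rabs_div, (Rabs_pos_eq y) by lra.
apply (Rmult_le_reg_r y); [exact Hy|].
replace (Rabs x / y * y) with (Rabs x) by (field; lra); exact H.
Qed.

(** The lower bound on the cosine lets the leading term dominate the relative O(r^2) error.
    Multiplying by l1 alpha cos (2 q t) covers all sign combinations in a single inequality. *)
Lemma equilibrium_determinant (q j : nat) (l1 alpha : R) (Phi : R -> R) (Rf : C -> R -> C)
  (K d : R) :
  (2 * q = j + 4)%nat -> (2 <= j)%nat -> l1 <> 0 -> alpha <> 0 -> smooth1 Phi ->
  (exists K d, 0 < d /\ forall s, Rabs s < d -> Rabs (Phi s - l1 * s) <= K * s ^ 2) ->
  smoothC3 Rf -> 0 < d ->
  (forall h x y m, 0 < h < d -> Rabs x <= h -> Rabs y <= h -> Rabs m < d ->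
     Rabs (Rre Rf x y m) <= K * h ^ (j + 5) /\ Rabs (Rim Rf x y m) <= K * h ^ (j + 5)) ->
  exists d', 0 < d' /\ forall mu r t, Rabs mu < d' -> 0 < r < d' ->
    is_equilibrium (garland_field q alpha Phi Rf mu) (r * cos t, r * sin t) ->
    1 / 2 <= Rabs (cos (2 * INR q * t)) ->
    l1 * alpha * cos (2 * INR q * t)
      * jac_det (garland_field q alpha Phi Rf mu) (r * cos t, r * sin t) < 0.
Proof.
intros Hq Hj Hl Hal HPhi HPhi0 HR Hd Hflat.
destruct (frequency_derivative_bound Phi l1 HPhi HPhi0) as [M [d0 [HM [Hd0 HF]]]].
assert (Hp : forall i g, (i < 2)%nat -> smooth3 g ->
  (forall h x y m, 0 < h < d -> Rabs x <= h -> Rabs y <= h -> Rabs m < d ->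
     Rabs (g x y m) <= K * h ^ (j + 5)) ->
  exists K' d', 0 <= K' /\ 0 < d' /\ forall r t m, 0 < r < d' -> Rabs m < d' ->
      Rabs (partial3 i g (r * cos t) (r * sin t) m / r ^ (j + 4)) <= K').
{ intros i g Hi Hg Hgf.
  replace (j + 5)%nat with (S (S (j + 3))) in Hgf by lia.
  destruct (flat_partial_bound (j + 3) i g K d Hi Hg Hd Hgf) as [K' [d' [HK' [Hd' H]]]].
  exists K', d'; split; [exact HK'|]; split; [exact Hd'|]; intros r t m Hr Hm.
  apply Rabs_div_le; [apply pow_lt; lra|].
  replace (j + 4)%nat with (S (j + 3)) by lia.
  assert (Hb : forall u, Rabs u <= 1 -> Rabs (r * u) <= r).
  { intros u Hu; rewrite Rabs_mult, (Rabs_pos_eq r) by lra.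
    rewrite <- (Rmult_1_r r) at 2; apply Rmult_le_compat_l; lra. }
  apply H; [exact Hr| | |exact Hm]; apply Hb, Rabs_le; [apply COS_bound|apply SIN_bound]. }
destruct (Hp 0%nat (Rre Rf) ltac:(lia) (proj1 HR)) as [Ka [da [HKa [Hda Pa]]]].
{ intros; apply Hflat; assumption. }
destruct (Hp 1%nat (Rre Rf) ltac:(lia) (proj1 HR)) as [Kb [db [HKb [Hdb Pb]]]].
{ intros; apply Hflat; assumption. }
destruct (Hp 0%nat (Rim Rf) ltac:(lia) (proj2 HR)) as [Kc [dc [HKc [Hdc Pc]]]].
{ intros; apply Hflat; assumption. }
destruct (Hp 1%nat (Rim Rf) ltac:(lia) (proj2 HR)) as [Kd [dd [HKd [Hdd Pd]]]].
{ intros; apply Hflat; assumption. }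
clear Hp.
set (B := 1 + M + 2 * Rabs K + Ka + Kb + Kc + Kd).
assert (HK := Rabs_pos K).
destruct (determinant_expansion l1 alpha (INR (j + 3)) B) as [L HL].
(* This bounds |l1 alpha cos (2 q t)| from below. The requirement r < u0 / (|L| + 1) then keeps |s
   X| below [u0], since s = r^2 <= r. *)
set (u0 := Rabs (l1 * alpha) / 2).
assert (Hu0 : 0 < u0).
{ apply Rdiv_lt_0_compat; [|lra]; apply Rabs_pos_lt.
  apply Rmult_integral_contrapositive; split; assumption. }
assert (HLp := Rabs_pos L).
set (d' := Rmin (Rmin (Rmin 1 (u0 / (Rabs L + 1))) (Rmin d d0))
                (Rmin (Rmin da db) (Rmin dc dd))).
assert (Hd' : 0 < d').
{ repeat apply Rmin_glb_lt; try lra; apply Rdiv_lt_0_compat; lra. }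
assert (Hmin : forall a b c, a <= Rmin b c -> a <= b /\ a <= c).
{ intros a b c H; split; (eapply Rle_trans; [exact H|]); [apply Rmin_l|apply Rmin_r]. }
destruct (Hmin _ _ _ (Rle_refl d')) as [M1 M2].
apply Hmin in M1; destruct M1 as [M1 M3]; apply Hmin in M1; destruct M1 as [M1 M4].
apply Hmin in M3; destruct M3 as [M3 M5]; apply Hmin in M2; destruct M2 as [M2 M6].
apply Hmin in M2; destruct M2 as [M2 M7]; apply Hmin in M6; destruct M6 as [M6 M8].
exists d'; split; [exact Hd'|]; intros mu r t Hmu Hr Heq Hcos.
destruct (garland_jacobian q alpha Phi Rf mu (r * cos t) (r * sin t) HPhi HR)
  as [_ [Ja [Jb [Jc Jd]]]].
assert (Htrig := sin2_cos2 t); unfold Rsqr in Htrig.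
assert (Er : (r * cos t) ^ 2 + (r * sin t) ^ 2 = r ^ 2).
{ transitivity (r ^ 2 * (sin t * sin t + cos t * cos t)); [|rewrite Htrig]; ring. }
(* The polar equations are used at scale a = r and radius 1, so that the first one expresses mu +
   Phi exactly. *)
assert (Heq' : is_equilibrium (garland_field q alpha Phi Rf mu) (r * 1 * cos t, r * 1 * sin t)).
{ rewrite Rmult_1_r; exact Heq. }
apply (polar_equilibrium q j l1 alpha Phi Rf mu r 1 t Hq Hl Hal ltac:(lra) ltac:(lra)) in Heq'.
destruct Heq' as [Heq' _]; unfold radial_error in Heq'.
rewrite !Rmult_1_r, !pow1, Rinv_1 in Heq'.
rewrite Er in Ja, Jb, Jc, Jd.
replace (2 * q - 1)%nat with (j + 3)%nat in Ja, Jb, Jc, Jd by lia.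
replace (pred (j + 3)) with (j + 2)%nat in Ja, Jb, Jc, Jd by lia.
rewrite Cpow_conj_polar in Ja, Jb, Jc, Jd; cbn [fst snd] in Ja, Jb, Jc, Jd.
set (N := cos t * Rim Rf (r * cos t) (r * sin t) mu
          + sin t * Rre Rf (r * cos t) (r * sin t) mu * -1) in *.
set (e := cos (2 * INR q * t)) in *.
set (co := cos t) in *; set (si := sin t) in *.
set (cn := cos (INR (j + 2) * t)) in *; set (sn := sin (INR (j + 2) * t)) in *.
assert (Htrig2 : sn * sn + cn * cn = 1) by exact (sin2_cos2 _).
assert (He : e = (co * co - si * si) * cn - 2 * si * co * sn).
{ unfold e, co, si; rewrite <- cos_2a, <- sin_2a; unfold cn, sn; rewrite <- cos_plus; f_equal.
  replace (2 * INR q) with (INR (2 + (j + 2))).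
  - rewrite plus_INR; simpl (INR 2); ring.
  - replace (2 + (j + 2))%nat with (2 * q)%nat by lia; rewrite mult_INR; reflexivity. }
set (s := r ^ 2); set (k := r ^ (j - 2)).
assert (Hw : s * k = r ^ j) by (unfold s, k; rewrite <- pow_add; f_equal; lia).
assert (Hs : 0 < s) by (apply pow_lt; lra).
assert (Hrj : 0 < r ^ j) by (apply pow_lt; lra).
assert (Hsr : s <= r) by (unfold s; nra).
(* From here on all quantities are scaled by their natural power of [r] and bounded by [B]; [nu] is
   the scaled tangential component of the remainder. *)
set (p0 := (Derive Phi (r ^ 2) - l1) / s).
set (nu := N / r ^ (j + 5)).
set (ra := partial3 0 (Rre Rf) (r * co) (r * si) mu / r ^ (j + 4)).
set (rb := partial3 1 (Rre Rf) (r * co) (r * si) mu / r ^ (j + 4)).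
set (rc := partial3 0 (Rim Rf) (r * co) (r * si) mu / r ^ (j + 4)).
set (rd := partial3 1 (Rim Rf) (r * co) (r * si) mu / r ^ (j + 4)).
assert (P4 : r ^ (j + 4) = s * (s * (s * k))).
{ rewrite Hw; unfold s; rewrite pow_add; ring. }
assert (P5 : r ^ (j + 5) = r * (s * (s * (s * k)))).
{ rewrite Hw; unfold s; rewrite pow_add; ring. }
assert (P2 : r ^ (j + 2) = s * (s * k)).
{ rewrite Hw; unfold s; rewrite pow_add; ring. }
assert (Hk : 0 < k) by (apply pow_lt; lra).
assert (Hco : Rabs co <= 1) by apply Rabs_le, COS_bound.
assert (Hsi : Rabs si <= 1) by apply Rabs_le, SIN_bound.
assert (Hb : forall u, Rabs u <= 1 -> Rabs (r * u) <= r).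
{ intros u Hu; rewrite Rabs_mult, (Rabs_pos_eq r) by lra.
  rewrite <- (Rmult_1_r r) at 2; apply Rmult_le_compat_l; lra. }
destruct (HL co si cn sn s k p0 nu ra rb rc rd) as [X [HX HD]]; try assumption.
- unfold B; lra.
- unfold B; lra.
- apply Rle_trans with 1; [apply Rabs_le, COS_bound|unfold B; lra].
- apply Rle_trans with 1; [apply Rabs_le, SIN_bound|unfold B; lra].
- rewrite Rabs_pos_eq by lra; unfold B; lra.
- rewrite Rabs_pos_eq by lra; apply Rle_trans with 1; [|unfold B; lra].
  unfold k; rewrite <- (pow1 (j - 2)); apply pow_incr; lra.
- apply Rle_trans with M; [|unfold B; lra].
  apply Rabs_div_le; [exact Hs|].
  apply (HF s (r ^ 2)); [lra|]; fold s; rewrite Rabs_pos_eq; lra.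
- apply Rle_trans with (2 * Rabs K); [|unfold B; lra].
  assert (H5 : 0 < r ^ (j + 5)) by (apply pow_lt; lra).
  apply Rabs_div_le; [exact H5|].
  destruct (Hflat r (r * co) (r * si) mu) as [F1 F2]; try lra; try (apply Hb; assumption).
  assert (HKK : K * r ^ (j + 5) <= Rabs K * r ^ (j + 5)).
  { apply Rmult_le_compat_r; [lra|apply Rle_abs]. }
  unfold N; replace (2 * Rabs K * r ^ (j + 5))
    with (1 * (Rabs K * r ^ (j + 5)) + 1 * (Rabs K * r ^ (j + 5)) * 1) by ring.
  apply Rabs_plus_bound; [apply Rabs_mult_bound; lra|].
  apply Rabs_mult_bound; [apply Rabs_mult_bound; lra|rewrite Rabs_left; lra].
- apply Rle_trans with Ka; [apply Pa; lra|unfold B; lra].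
- apply Rle_trans with Kb; [apply Pb; lra|unfold B; lra].
- apply Rle_trans with Kc; [apply Pc; lra|unfold B; lra].
- apply Rle_trans with Kd; [apply Pd; lra|unfold B; lra].
- rewrite <- He in HD.
  assert (Hm : mu + Phi (r ^ 2) = s * (s * k * (- alpha * e - s * nu))).
  { unfold nu; rewrite P5.
    assert (Hz : mu + Phi (r ^ 2) + alpha * r ^ (j + 2) * e + N / r = 0).
    { rewrite <- Heq'; rewrite pow_add; field; lra. }
    rewrite P2 in Hz.
    replace (mu + Phi (r ^ 2)) with (- (alpha * (s * (s * k)) * e) - N / r) by lra.
    field; lra. }
  assert (Hdp : Derive Phi (r ^ 2) = l1 + s * p0) by (unfold p0; field; lra).
  assert (Hdet : jac_det (garland_field q alpha Phi Rf mu) (r * co, r * si) =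
            s * s * (s * k * (- (2 * (INR (j + 3) + 1) * l1 * alpha * e) + s * X))).
  { rewrite <- HD; unfold jac_det; rewrite Ja, Jb, Jc, Jd, Hm, Hdp, P2.
    assert (Hrr : r * r = s) by (unfold s; ring).
    assert (G : forall g, s * (s * (s * k)) * (g / r ^ (j + 4)) = g) by (intros g; rewrite P4; field; lra).
    rewrite <- (G (partial3 0 (Rre Rf) (r * co) (r * si) mu)), <- (G (partial3 1 (Rre Rf) (r * co) (r * si) mu)),
      <- (G (partial3 0 (Rim Rf) (r * co) (r * si) mu)), <- (G (partial3 1 (Rim Rf) (r * co) (r * si) mu)).
    fold ra rb rc rd; clearbody ra rb rc rd.
    rewrite !Rpow_mult_distr; fold s.
    replace (2 * (r * co) * (r * si)) with (2 * s * co * si) by ring [Hrr].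
    clearbody s k; ring. }
  rewrite Hdet.
  set (u := l1 * alpha * e).
  assert (Hu : u0 <= Rabs u).
  { unfold u, u0; rewrite (Rabs_mult (l1 * alpha)); unfold Rdiv; apply Rmult_le_compat_l; [apply Rabs_pos|lra]. }
  assert (HsX : Rabs (s * X) < u0).
  { rewrite Rabs_mult, (Rabs_pos_eq s) by lra.
    apply Rle_lt_trans with (s * (Rabs L + 1)).
    - apply Rmult_le_compat_l; [lra|]; assert (H := Rle_abs L); lra.
    - replace u0 with (u0 / (Rabs L + 1) * (Rabs L + 1)) by (field; lra).
      apply Rmult_lt_compat_r; lra. }
  assert (Hn : 0 <= INR (j + 3)) by apply pos_INR.
  (* The term - 2 u^2 outweighs |u| |s X|, which is less than u^2. *)
  assert (Hneg : u * (- (2 * (INR (j + 3) + 1) * u) + s * X) < 0).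
  { assert (H1 : u * (s * X) <= Rabs u * Rabs (s * X)).
    { rewrite <- Rabs_mult; apply Rle_abs. }
    assert (H2 : u * u = Rabs u * Rabs u).
    { rewrite <- Rabs_mult, Rabs_pos_eq; [reflexivity|apply Rle_0_sqr]. }
    assert (H3 : Rabs u * Rabs (s * X) < Rabs u * Rabs u) by (apply Rmult_lt_compat_l; lra).
    assert (H4 : 0 < Rabs u * Rabs u) by (apply Rmult_lt_0_compat; lra).
    assert (H5 : 0 <= INR (j + 3) * (Rabs u * Rabs u)) by (apply Rmult_le_pos; lra).
    replace (u * (- (2 * (INR (j + 3) + 1) * u) + s * X))
      with (- (2 * (INR (j + 3) * (u * u)) + 2 * (u * u)) + u * (s * X)) by ring.
    rewrite H2; lra. }
  replace (u * (s * s * (s * k * (- (2 * (INR (j + 3) + 1) * l1 * alpha * e) + s * X))))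
    with (- (s * s * (s * k) * - (u * (- (2 * (INR (j + 3) + 1) * u) + s * X)))) by (unfold u; ring).
  apply Ropp_lt_gt_0_contravar, Rmult_lt_0_compat; [|lra].
  apply Rmult_lt_0_compat; apply Rmult_lt_0_compat; assumption.
Qed.

(** * Flatness in components and the equilibrium at the origin *)

Lemma flat_components (Rf : C -> R -> C) (n : nat) :
  (exists K d, 0 < d /\ forall (z : C) (mu : R), Cmod z < d -> Rabs mu < d ->
     Cmod (Rf z mu) <= K * Cmod z ^ n) ->
  exists K d, 0 < d /\ forall h x y m, 0 < h < d -> Rabs x <= h -> Rabs y <= h -> Rabs m < d ->
    Rabs (Rre Rf x y m) <= K * h ^ n /\ Rabs (Rim Rf x y m) <= K * h ^ n.
Proof.
intros [K [d [Hd H]]].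
(* On the box of size [h] the modulus is at most sqrt 2 h, rounded up to 2h. *)
exists (Rabs K * 2 ^ n), (d / 2); split; [lra|]; intros h x y m Hh Hx Hy Hm.
assert (Hc : Cmod (x, y) <= 2 * h).
{ eapply Rle_trans; [apply Cmod_2Rmax|]; simpl.
  apply Rmult_le_compat; [apply sqrt_pos| | |apply Rmax_lub; assumption].
  - eapply Rle_trans; [apply Rabs_pos|apply Rmax_l].
  - rewrite <- (sqrt_square 2) at 2 by lra; apply sqrt_le_1; lra. }
assert (HR : Cmod (Rf (x, y) m) <= Rabs K * 2 ^ n * h ^ n).
{ eapply Rle_trans; [apply H; lra|].
  rewrite Rmult_assoc, <- Rpow_mult_distr.
  apply Rle_trans with (Rabs K * Cmod (x, y) ^ n).
  - apply Rmult_le_compat_r; [apply pow_le, Cmod_ge_0|apply Rle_abs].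
  - apply Rmult_le_compat_l; [apply Rabs_pos|].
    apply pow_incr; split; [apply Cmod_ge_0|exact Hc]. }
assert (HM := Rmax_Cmod (Rf (x, y) m)).
split; (eapply Rle_trans; [|exact HR]); (eapply Rle_trans; [|exact HM]);
  [apply Rmax_l|apply Rmax_r].
Qed.

Lemma zero_of_small_multiples (x K d : R) :
  0 < d -> (forall h, 0 < h < d -> Rabs x <= K * h) -> x = 0.
Proof.
intros Hd H; destruct (Req_dec x 0) as [|Hx]; [assumption|exfalso].
assert (Hp := Rabs_pos_lt x Hx); assert (HK := Rabs_pos K).
(* This choice makes K h at most |x| / 2, which contradicts |x| <= K h. *)
set (h := Rmin (d / 2) (Rabs x / (2 * (Rabs K + 1)))).
assert (H0 : 0 < Rabs x / (2 * (Rabs K + 1))) by (apply Rdiv_lt_0_compat; lra).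
assert (Hh : 0 < h) by (apply Rmin_glb_lt; lra).
assert (Hl : h <= d / 2) by apply Rmin_l.
assert (Hr : h <= Rabs x / (2 * (Rabs K + 1))) by apply Rmin_r.
assert (H1 := H h ltac:(lra)).
assert (H2 : K * h <= (Rabs K + 1) * h).
{ apply Rmult_le_compat_r; [lra|]; assert (H2 := Rle_abs K); lra. }
assert (H3 : (Rabs K + 1) * h <= Rabs x / 2).
{ replace (Rabs x / 2) with ((Rabs K + 1) * (Rabs x / (2 * (Rabs K + 1)))) by (field; lra).
  apply Rmult_le_compat_l; lra. }
lra.
Qed.

(** Flatness for every small [h] makes the remainder and its first partials in x and y vanish at 0,
    so the linearization is the infinitesimal rotation by mu, of determinant mu^2. *)
Lemma origin_is_center (q j : nat) (alpha : R) (Phi : R -> R) (Rf : C -> R -> C) (K d : R) :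
  (2 * q = j + 4)%nat -> smooth1 Phi -> Phi 0 = 0 -> smoothC3 Rf -> 0 < d ->
  (forall h x y m, 0 < h < d -> Rabs x <= h -> Rabs y <= h -> Rabs m < d ->
     Rabs (Rre Rf x y m) <= K * h ^ (j + 5) /\ Rabs (Rim Rf x y m) <= K * h ^ (j + 5)) ->
  exists d', 0 < d' /\ forall mu, 0 < Rabs mu < d' ->
    divergence (garland_field q alpha Phi Rf mu) 0%C = 0 ->
    is_center (garland_field q alpha Phi Rf mu) 0%C.
Proof.
intros Hq HPhi HPhi0 HR Hd Hflat.
assert (Hlin : forall x K n d, 0 < d -> (forall h, 0 < h < d -> Rabs x <= K * h ^ S n) -> x = 0).
{ intros x K' n d' Hd' H; apply (zero_of_small_multiples x (Rabs K') (Rmin 1 d')).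
  - apply Rmin_glb_lt; lra.
  - intros h Hh; assert (H1 := Rmin_l 1 d'); assert (H2 := Rmin_r 1 d').
    eapply Rle_trans; [apply (H h); lra|].
    apply Rle_trans with (Rabs K' * h ^ S n).
    + apply Rmult_le_compat_r; [apply pow_le; lra|apply Rle_abs].
    + apply Rmult_le_compat_l; [apply Rabs_pos|].
      rewrite <- tech_pow_Rmult; rewrite <- (Rmult_1_r h) at 3.
      apply Rmult_le_compat_l; [lra|]; rewrite <- (pow1 n); apply pow_incr; lra. }
assert (Hval : forall mu, Rabs mu < d -> Rre Rf 0 0 mu = 0 /\ Rim Rf 0 0 mu = 0).
{ intros mu Hmu; replace (j + 5)%nat with (S (j + 4)) in Hflat by lia.
  split; apply (Hlin _ K (j + 4)%nat d Hd); intros h Hh; apply Hflat; try rewrite Rabs_R0; lra. }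
assert (Hp : forall i g, (i < 2)%nat -> smooth3 g ->
  (forall h x y m, 0 < h < d -> Rabs x <= h -> Rabs y <= h -> Rabs m < d ->
     Rabs (g x y m) <= K * h ^ (j + 5)) ->
  exists d', 0 < d' /\ forall mu, Rabs mu < d' -> partial3 i g 0 0 mu = 0).
{ intros i g Hi Hg Hgf; replace (j + 5)%nat with (S (S (j + 3))) in Hgf by lia.
  destruct (flat_partial_bound (j + 3) i g K d Hi Hg Hd Hgf) as [K' [d' [_ [Hd' H]]]].
  exists d'; split; [exact Hd'|]; intros mu Hmu.
  apply (Hlin _ K' (j + 3)%nat d' Hd'); intros h Hh; apply H; try rewrite Rabs_R0; lra. }
destruct (Hp 0%nat (Rre Rf) ltac:(lia) (proj1 HR)) as [da [Hda Pa]].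
{ intros; apply Hflat; assumption. }
destruct (Hp 1%nat (Rre Rf) ltac:(lia) (proj1 HR)) as [db [Hdb Pb]].
{ intros; apply Hflat; assumption. }
destruct (Hp 0%nat (Rim Rf) ltac:(lia) (proj2 HR)) as [dc [Hdc Pc]].
{ intros; apply Hflat; assumption. }
destruct (Hp 1%nat (Rim Rf) ltac:(lia) (proj2 HR)) as [dd [Hdd Pd]].
{ intros; apply Hflat; assumption. }
exists (Rmin d (Rmin (Rmin da db) (Rmin dc dd))).
split; [repeat apply Rmin_glb_lt; assumption|]; intros mu [Hmu0 Hmu] Hdiv.
assert (Hmin : forall a b c, a < Rmin b c -> a < b /\ a < c).
{ intros a b c H; split; (eapply Rlt_le_trans; [exact H|]); [apply Rmin_l|apply Rmin_r]. }
apply Hmin in Hmu; destruct Hmu as [Hmu H2]; apply Hmin in H2; destruct H2 as [H2 H3].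
apply Hmin in H2; apply Hmin in H3; destruct H2 as [M1 M2]; destruct H3 as [M3 M4].
destruct (garland_jacobian q alpha Phi Rf mu 0 0 HPhi HR) as [Hpar [Ja [Jb [Jc Jd]]]].
assert (Hz : 0 ^ 2 + 0 ^ 2 = 0) by ring.
assert (Hc : forall n, Cpow (0, - 0) (S n) = (0, 0)).
{ intros n; rewrite Cpow_S; unfold Cmult; simpl; f_equal; ring. }
replace (2 * q - 1)%nat with (S (S (j + 1))) in Ja, Jb, Jc, Jd by lia.
cbn [pred] in Ja, Jb, Jc, Jd.
rewrite Hz, Hc in Ja, Jb, Jc, Jd; rewrite HPhi0 in Jb, Jc; cbn [fst snd] in Ja, Jb, Jc, Jd.
rewrite Pa in Ja by exact M1; rewrite Pb in Jb by exact M2.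
rewrite Pc in Jc by exact M3; rewrite Pd in Jd by exact M4.
change (RtoC 0) with ((0, 0) : C) in *.
apply center_of_det_pos; [|exact Hpar|exact Hdiv|].
- unfold is_equilibrium; rewrite garland_components.
  destruct (Hval mu Hmu) as [-> ->]; rewrite Hz, HPhi0.
  replace (2 * q - 1)%nat with (S (S (j + 1))) by lia; rewrite Hc.
  unfold RtoC; cbn [fst snd]; f_equal; ring.
- unfold jac_det; rewrite Ja, Jb, Jc, Jd.
  match goal with |- 0 < ?X => replace X with (mu * mu) by ring end.
  apply Rsqr_pos_lt; intros ->; rewrite Rabs_R0 in Hmu0; lra.
Qed.

(** * Equilibria in a sector *)

Lemma sin_cos_add_kPI (k : nat) (x : R) :
  sin (INR k * PI + x) = (-1) ^ k * sin x /\ cos (INR k * PI + x) = (-1) ^ k * cos x.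
Proof.
induction k as [|k [IHs IHc]].
- simpl; rewrite Rmult_0_l, Rplus_0_l; lra.
- rewrite S_INR; replace ((INR k + 1) * PI + x) with (INR k * PI + x + PI) by ring.
  rewrite neg_sin, neg_cos, IHs, IHc; simpl; lra.
Qed.

(** The value 1/2 fixes the half-width PI / 3 of the sectors: it is both the expansion rate of the
    sine there and the bound on |cos (2 q t)| that the determinant estimate asks for. *)
Lemma cos_ge_half (x : R) : Rabs x <= PI / 3 -> 1 / 2 <= cos x.
Proof.
intros Hx; assert (HP := PI_RGT_0); rewrite <- cos_PI3.
assert (Ha := Rabs_pos x).
replace (cos x) with (cos (Rabs x)).
- apply cos_decr_1; lra.
- unfold Rabs; destruct (Rcase_abs x); [apply cos_neg|reflexivity].
Qed.

Lemma sin_expanding (x y : R) :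
  Rabs x <= PI / 3 -> Rabs y <= PI / 3 -> 1 / 2 * Rabs (x - y) <= Rabs (sin x - sin y).
Proof.
intros Hx Hy; destruct (MVT_gen sin y x cos) as [c [Hc Heq]].
- intros t _; auto_derive; [trivial|ring].
- intros t _; apply continuity_sin.
- rewrite Heq, Rabs_mult; apply Rmult_le_compat_r; [apply Rabs_pos|].
  eapply Rle_trans; [|apply Rle_abs]; apply cos_ge_half.
  apply Rabs_le_between in Hx; apply Rabs_le_between in Hy; apply Rabs_le.
  revert Hc; unfold Rmin, Rmax; destruct (Rle_dec y x); lra.
Qed.

(** Every direction lies in a sector of half-width PI / 2; the angular equation makes the sine small
    at an equilibrium, which confines it to the narrower sector. The threshold works because sin (PI
    / 3) >= PI / 6 > 1 / 4. *)
Lemma small_sine (x : R) : Rabs x <= PI / 2 -> Rabs (sin x) <= 1 / 4 -> Rabs x <= PI / 3.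
Proof.
intros Hx Hs; assert (HP := PI2_3_2).
assert (H3 : 1 / 2 <= sin (PI / 3)).
{ assert (H := sin_expanding (PI / 3) 0); rewrite sin_0, !Rminus_0_r, Rabs_R0 in H.
  assert (H0 : 0 < sin (PI / 3)) by (apply sin_gt_0; lra).
  rewrite (Rabs_pos_eq (sin _)), Rabs_pos_eq in H by lra; lra. }
apply Rabs_le_between in Hx; apply Rabs_le_between in Hs.
apply Rabs_le; split; apply Rnot_lt_le; intros H.
- assert (H4 : sin x < sin (- (PI / 3))) by (apply sin_increasing_1; lra).
  rewrite sin_neg in H4; lra.
- assert (H4 : sin (PI / 3) < sin x) by (apply sin_increasing_1; lra); lra.
Qed.

(** Here cos (x - y) = 1, so the sine of the half difference vanishes, and that half lies strictly
    between - PI and PI. *)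
Lemma angle_unique (x y : R) :
  Rabs (x - y) < 2 * PI -> cos x = cos y -> sin x = sin y -> x = y.
Proof.
intros H Hc Hs.
assert (H1 : cos (x - y) = 1).
{ rewrite cos_minus, Hc, Hs; assert (E := sin2_cos2 y); unfold Rsqr in E; lra. }
assert (H2 : sin ((x - y) / 2) = 0).
{ replace (x - y) with (2 * ((x - y) / 2)) in H1 by field.
  rewrite cos_2a_sin in H1; apply Rsqr_0_uniq; unfold Rsqr; lra. }
apply Rabs_lt_between in H.
set (u := (x - y) / 2) in *; assert (E : x - y = 2 * u) by (unfold u; field).
destruct (Rtotal_order u 0) as [Hu|[Hu|Hu]]; [|lra|].
- assert (0 < sin (- u)) by (apply sin_gt_0; lra); rewrite sin_neg in *; lra.
- assert (0 < sin u) by (apply sin_gt_0; lra); lra.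
Qed.

Lemma polar_form (z : C) :
  exists t, - PI <= t <= PI /\ z = (Cmod z * cos t, Cmod z * sin t).
Proof.
destruct z as [x y]; set (r := Cmod (x, y)).
assert (HP := PI_RGT_0).
assert (Hr : r ^ 2 = x ^ 2 + y ^ 2).
{ unfold r, Cmod; simpl fst; simpl snd; apply pow2_sqrt.
  apply Rplus_le_le_0_compat; apply pow2_ge_0. }
destruct (Req_dec r 0) as [H0|H0].
- exists 0; split; [lra|]; unfold r in H0; rewrite (Cmod_eq_0 _ H0) at 1.
  fold r; unfold r; rewrite H0; unfold RtoC; f_equal; ring.
- assert (Hr0 : 0 < r) by (assert (H := Cmod_ge_0 (x, y)); fold r in H; lra).
  assert (Hxr : -1 <= x / r <= 1).
  { apply Rabs_le_between, Rabs_div_le; [exact Hr0|]; rewrite Rmult_1_l.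
    exact (re_le_Cmod (x, y)). }
  destruct (acos_bound (x / r)) as [A1 A2].
  assert (Hc := cos_acos _ Hxr); set (t := acos (x / r)) in *.
  assert (Hx : x = r * cos t) by (rewrite Hc; field; exact H0).
  assert (Hs : 0 <= r * sin t) by (apply Rmult_le_pos; [lra|apply sin_ge_0; lra]).
  assert (Hy : Rsqr y = Rsqr (r * sin t)).
  { assert (E := sin2_cos2 t).
    transitivity (r ^ 2 * (Rsqr (sin t) + Rsqr (cos t)) - Rsqr (r * cos t)).
    - rewrite E, <- Hx, Hr; unfold Rsqr; ring.
    - unfold Rsqr; ring. }
  destruct (Rle_lt_dec 0 y) as [Hy0|Hy0].
  + exists t; split; [lra|]; rewrite <- Hx; f_equal; apply Rsqr_inj; assumption.
  + exists (- t); split; [lra|]; rewrite cos_neg, sin_neg, <- Hx; f_equal.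
    rewrite Rsqr_neg in Hy; apply Rsqr_inj in Hy; [|lra|exact Hs]; lra.
Qed.

Lemma nearest_sector (q : nat) (t : R) :
  (0 < q)%nat -> - PI <= t <= PI ->
  exists k psi, (k < 4 * q)%nat /\ Rabs psi <= PI / 2 /\
    let t' := (INR k * PI + psi) / (2 * INR q) in cos t' = cos t /\ sin t' = sin t.
Proof.
intros Hq Ht; assert (HP := PI_RGT_0).
assert (HQ : 0 < INR q) by (apply lt_0_INR; exact Hq).
set (x := 2 * INR q * t / PI).
assert (Hx : - (2 * INR q) <= x <= 2 * INR q).
{ apply Rabs_le_between; unfold x; apply Rabs_div_le; [exact HP|].
  rewrite Rabs_mult, Rabs_pos_eq by lra; apply Rmult_le_compat_l; [lra|].
  apply Rabs_le; exact Ht. }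
(* This rounds [x] to a nearest integer: x - 1/2 < n <= x + 1/2. *)
destruct (archimed (x - 1 / 2)) as [N1 N2]; set (n := up (x - 1 / 2)) in *.
rewrite INR_IZR_INZ in Hx.
assert (L1 : (- (2 * Z.of_nat q) - 1 < n)%Z).
{ apply lt_IZR; rewrite minus_IZR, opp_IZR, mult_IZR; lra. }
assert (L2 : (n < 2 * Z.of_nat q + 1)%Z).
{ apply lt_IZR; rewrite plus_IZR, mult_IZR; lra. }
set (psi := 2 * INR q * t - IZR n * PI).
assert (Hpsi : Rabs psi <= PI / 2).
{ replace psi with ((x - IZR n) * PI) by (unfold psi, x; field; lra).
  rewrite Rabs_mult, (Rabs_pos_eq PI) by lra.
  replace (PI / 2) with (1 / 2 * PI) by field.
  apply Rmult_le_compat_r; [lra|]; apply Rabs_le; lra. }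
destruct (Z_le_gt_dec 0 n) as [Hn|Hn].
- exists (Z.to_nat n), psi; split; [lia|]; split; [exact Hpsi|]; cbv zeta.
  rewrite INR_IZR_INZ, Z2Nat.id by lia.
  replace ((IZR n * PI + psi) / (2 * INR q)) with t by (unfold psi; field; lra).
  split; reflexivity.
(* A negative index is shifted by 4q, which turns the angle by a full 2 PI; as n >= - 2q, the new
   index is in range. *)
- exists (Z.to_nat (n + 4 * Z.of_nat q)), psi; split; [lia|]; split; [exact Hpsi|]; cbv zeta.
  rewrite INR_IZR_INZ, Z2Nat.id by lia; rewrite plus_IZR, mult_IZR, <- INR_IZR_INZ.
  replace (((IZR n + 4 * INR q) * PI + psi) / (2 * INR q)) with (t + 2 * INR 1 * PI)
    by (unfold psi; simpl; field; lra).
  split; [apply cos_period|apply sin_period].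
Qed.

Lemma pow_minus_one_square (k : nat) : (-1) ^ k * (-1) ^ k = 1.
Proof. rewrite <- Rpow_mult_distr; replace (-1 * -1) with 1 by ring; apply pow1. Qed.

(** Since sin (k PI + psi) = (-1)^k sin psi, multiplying the angular equation by (-1)^k gives every
    sector the same model r^2 - 1 = 0, sin psi = 0, up to errors of size and slope at most 1/16. The
    condition w >= 1 keeps the angle 1-Lipschitz in psi. *)
Lemma sector_root (w kappa : R) (k : nat) (E1 E2 : R -> R -> R) :
  1 <= w -> kappa <= 1 / 16 -> bounded_lip kappa E1 -> bounded_lip kappa E2 ->
  let t psi := (INR k * PI + psi) / w in
  let root r psi := r ^ 2 - 1 + E1 r (t psi) = 0 /\ sin (w * t psi) + E2 r (t psi) = 0 in
  (exists r psi, 1 / 2 <= r <= 2 /\ Rabs psi <= PI / 3 /\ root r psi) /\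
  (forall r psi r' psi', 1 / 2 <= r <= 2 -> Rabs psi <= PI / 3 ->
     1 / 2 <= r' <= 2 -> Rabs psi' <= PI / 3 ->
     root r psi -> root r' psi' -> r = r' /\ psi = psi').
Proof.
intros Hw Hkappa H1 H2 t root.
assert (HP := PI2_3_2).
assert (Hsg := pow_minus_one_square k).
set (sg := (-1) ^ k) in *.
assert (Hsga : Rabs sg = 1) by apply pow_1_abs.
set (A := fun r psi => r ^ 2 - 1 + E1 r (t psi)).
set (B := fun r psi => sin psi + sg * E2 r (t psi)).
assert (Hroot : forall r psi, root r psi <-> A r psi = 0 /\ B r psi = 0).
{ intros r psi; unfold root, A, B.
  replace (w * t psi) with (INR k * PI + psi) by (unfold t; field; lra).
  destruct (sin_cos_add_kPI k psi) as [-> _]; fold sg.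
  split; intros [R1 R2]; (split; [exact R1|]).
  - apply (Rmult_eq_reg_l sg); [|intros E; rewrite E, Rabs_R0 in Hsga; lra].
    rewrite Rmult_0_r, <- R2; rewrite Rmult_plus_distr_l, <- Rmult_assoc, Hsg; ring.
  - apply (Rmult_eq_reg_l sg); [|intros E; rewrite E, Rabs_R0 in Hsga; lra].
    rewrite Rmult_0_r, <- R2; rewrite Rmult_plus_distr_l, <- Rmult_assoc, Hsg; ring. }
assert (Ht : forall psi psi', Rabs (t psi - t psi') <= Rabs (psi - psi')).
{ intros psi psi'; replace (t psi - t psi') with ((psi - psi') / w) by (unfold t; field; lra).
  apply Rabs_div_le; [lra|]; rewrite <- (Rmult_1_r (Rabs _)) at 1.
  apply Rmult_le_compat_l; [apply Rabs_pos|exact Hw]. }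
assert (Hk0 := bounded_lip_pos _ _ H1).
assert (Er : forall E r r' psi, bounded_lip kappa E -> 1 / 2 <= r <= 2 -> 1 / 2 <= r' <= 2 ->
          Rabs (E r (t psi) - E r' (t psi)) <= 1 / 16 * Rabs (r - r')).
{ intros E r r' psi HE Hr Hr'; destruct (HE r (t psi) r' (t psi) Hr Hr') as [_ H].
  rewrite Rminus_diag, Rabs_R0, Rplus_0_r in H; eapply Rle_trans; [exact H|].
  apply Rmult_le_compat_r; [apply Rabs_pos|exact Hkappa]. }
assert (Ep : forall E r psi psi', bounded_lip kappa E -> 1 / 2 <= r <= 2 ->
          Rabs (E r (t psi) - E r (t psi')) <= 1 / 16 * Rabs (psi - psi')).
{ intros E r psi psi' HE Hr; destruct (HE r (t psi) r (t psi') Hr Hr) as [_ H].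
  rewrite Rminus_diag, Rabs_R0, Rplus_0_l in H; eapply Rle_trans; [exact H|].
  apply Rmult_le_compat; [exact Hk0|apply Rabs_pos|exact Hkappa|apply Ht]. }
assert (Eb : forall E r psi, bounded_lip kappa E -> 1 / 2 <= r <= 2 ->
          Rabs (E r (t psi)) <= 1 / 16).
{ intros E r psi HE Hr; destruct (HE r (t psi) r (t psi) Hr Hr) as [H _]; lra. }
assert (Hang : forall psi, - (PI / 3) <= psi <= PI / 3 -> Rabs psi <= PI / 3).
{ intros psi H; apply Rabs_le; exact H. }
(* The model expands by at least 1 in [r] and 1/2 in psi, and by at most 4. After the perturbation
   1/16 the rates 1/4 and 5 suit both equations, against the cross rate 1/16. *)
assert (HAx : forall x x' y, 1 / 2 <= x <= 2 -> 1 / 2 <= x' <= 2 -> - (PI / 3) <= y <= PI / 3 ->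
   1 / 4 * Rabs (x - x') <= Rabs (A x y - A x' y) <= 5 * Rabs (x - x')).
{ intros x x' y Hx Hx' _; assert (H := Er E1 x x' y H1 Hx Hx').
  assert (H0 := Rabs_pos (x - x')).
  assert (Hsq : Rabs (x ^ 2 - x' ^ 2) = (x + x') * Rabs (x - x')).
  { replace (x ^ 2 - x' ^ 2) with ((x + x') * (x - x')) by ring.
    rewrite Rabs_mult, Rabs_pos_eq by lra; reflexivity. }
  assert (L1 : 1 * Rabs (x - x') <= (x + x') * Rabs (x - x')) by (apply Rmult_le_compat_r; lra).
  assert (L2 : (x + x') * Rabs (x - x') <= 4 * Rabs (x - x')) by (apply Rmult_le_compat_r; lra).
  replace (A x y - A x' y) with (x ^ 2 - x' ^ 2 + (E1 x (t y) - E1 x' (t y)))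
    by (unfold A; ring).
  split.
  - assert (Hi := Rabs_triang_inv (x ^ 2 - x' ^ 2) (- (E1 x (t y) - E1 x' (t y)))).
    rewrite Rabs_Ropp in Hi.
    replace (x ^ 2 - x' ^ 2 - - (E1 x (t y) - E1 x' (t y)))
      with (x ^ 2 - x' ^ 2 + (E1 x (t y) - E1 x' (t y))) in Hi by ring.
    lra.
  - eapply Rle_trans; [apply Rabs_triang|]; lra. }
assert (HAy : forall x y y', 1 / 2 <= x <= 2 -> - (PI / 3) <= y <= PI / 3 ->
   - (PI / 3) <= y' <= PI / 3 -> Rabs (A x y - A x y') <= 1 / 16 * Rabs (y - y')).
{ intros x y y' Hx _ _.
  replace (A x y - A x y') with (E1 x (t y) - E1 x (t y')) by (unfold A; ring).
  apply Ep; assumption. }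
assert (HBy : forall x y y', 1 / 2 <= x <= 2 -> - (PI / 3) <= y <= PI / 3 ->
   - (PI / 3) <= y' <= PI / 3 ->
   1 / 4 * Rabs (y - y') <= Rabs (B x y - B x y') <= 5 * Rabs (y - y')).
{ intros x y y' Hx Hy Hy'; assert (H := Ep E2 x y y' H2 Hx).
  assert (H0 := Rabs_pos (y - y')).
  replace (B x y - B x y') with (sin y - sin y' + sg * (E2 x (t y) - E2 x (t y')))
    by (unfold B; ring).
  assert (Hd : Rabs (sg * (E2 x (t y) - E2 x (t y'))) = Rabs (E2 x (t y) - E2 x (t y'))).
  { rewrite Rabs_mult, Hsga; ring. }
  assert (S1 := sin_expanding y y' (Hang y Hy) (Hang y' Hy')).
  assert (S2 := sin_lipschitz y y').
  split.
  - assert (Hi := Rabs_triang_inv (sin y - sin y') (- (sg * (E2 x (t y) - E2 x (t y'))))).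
    rewrite Rabs_Ropp in Hi.
    replace (sin y - sin y' - - (sg * (E2 x (t y) - E2 x (t y'))))
      with (sin y - sin y' + sg * (E2 x (t y) - E2 x (t y'))) in Hi by ring.
    lra.
  - eapply Rle_trans; [apply Rabs_triang|]; lra. }
assert (HBx : forall x x' y, 1 / 2 <= x <= 2 -> 1 / 2 <= x' <= 2 -> - (PI / 3) <= y <= PI / 3 ->
   Rabs (B x y - B x' y) <= 1 / 16 * Rabs (x - x')).
{ intros x x' y Hx Hx' _.
  replace (B x y - B x' y) with (sg * (E2 x (t y) - E2 x' (t y))) by (unfold B; ring).
  rewrite Rabs_mult, Hsga, Rmult_1_l; apply Er; assumption. }
split.
- destruct (planar_root_exists A B (1 / 2) 2 (- (PI / 3)) (PI / 3) (1 / 4) (1 / 16) 5)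
    as [r [psi [Hr [Hpsi HAB]]]]; try assumption; try lra.
  + intros x y y' Hx Hy Hy'; apply HBy; assumption.
  + intros y Hy; unfold A.
    assert (L := Eb E1 (1 / 2) y H1 ltac:(lra)); assert (U := Eb E1 2 y H1 ltac:(lra)).
    apply Rabs_le_between in L; apply Rabs_le_between in U; lra.
  + intros x Hx.
    assert (H0 : forall y, - (PI / 3) <= y <= PI / 3 -> Rabs (sg * E2 x (t y)) <= 1 / 16).
    { intros y Hy; rewrite Rabs_mult, Hsga, Rmult_1_l; apply Eb; assumption. }
    assert (L := H0 (- (PI / 3)) ltac:(lra)); assert (U := H0 (PI / 3) ltac:(lra)).
    apply Rabs_le_between in L; apply Rabs_le_between in U.
    assert (S := sin_expanding (PI / 3) 0); rewrite sin_0, !Rminus_0_r, Rabs_R0 in S.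
    assert (S0 : 0 < sin (PI / 3)) by (apply sin_gt_0; lra).
    rewrite (Rabs_pos_eq (sin _)), Rabs_pos_eq in S by lra.
    unfold B; rewrite sin_neg; lra.
  + exists r, psi; split; [exact Hr|]; split; [apply Hang, Hpsi|]; apply Hroot, HAB.
- intros r psi r' psi' Hr Hpsi Hr' Hpsi' R1 R2.
  apply Hroot in R1; apply Hroot in R2; destruct R1 as [A1 B1]; destruct R2 as [A2 B2].
  apply Rabs_le_between in Hpsi; apply Rabs_le_between in Hpsi'.
  apply (planar_root_unique A B (1 / 2) 2 (- (PI / 3)) (PI / 3) (1 / 4) (1 / 16));
    try assumption; try lra.
  + intros x x' y Hx Hx' Hy; apply HAx; assumption.
  + intros x y y' Hx Hy Hy'; apply HBy; assumption.
Qed.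

(** * The garland *)

Lemma Cmod_polar (r t : R) : 0 <= r -> Cmod (r * cos t, r * sin t) = r.
Proof.
intros Hr; unfold Cmod; cbn [fst snd]; rewrite <- (sqrt_pow2 r Hr) at 3; f_equal.
assert (E := sin2_cos2 t).
transitivity (r ^ 2 * (Rsqr (sin t) + Rsqr (cos t))); [unfold Rsqr|rewrite E]; ring.
Qed.

Lemma pow_minus_one_parity (k : nat) :
  (Nat.even k = true -> (-1) ^ k = 1) /\ (Nat.even k = false -> (-1) ^ k = -1).
Proof.
induction k as [|k [IH1 IH2]].
- split; [reflexivity|discriminate].
- rewrite Nat.even_succ, <- Nat.negb_even; destruct (Nat.even k); cbn [negb].
  + split; [discriminate|]; intros _; simpl; rewrite IH1; [ring|reflexivity].
  + split; [|discriminate]; intros _; simpl; rewrite IH2; [ring|reflexivity].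
Qed.

Theorem theorem1 (q : nat) (l1 alpha : R) (Phi : R -> R) (Rf : C -> R -> C)
  (Hq3 : (3 <= q)%nat) (Hqodd : Nat.odd q = true)
  (Hl1 : l1 <> 0) (Halpha : alpha <> 0)
  (HPhi : smooth1 Phi)
  (HPhi0 : exists K d, 0 < d /\ forall s, Rabs s < d ->
             Rabs (Phi s - l1 * s) <= K * s ^ 2)
  (HR : smoothC3 Rf)
  (HR0 : exists K d, 0 < d /\ forall (z : C) (mu : R), Cmod z < d -> Rabs mu < d ->
             Cmod (Rf z mu) <= K * Cmod z ^ (2 * q + 1))
  (Hdiv : forall (mu : R) (z : C), divergence (garland_field q alpha Phi Rf mu) z = 0) :
  exists U : C -> Prop,
    (exists r, 0 < r /\ forall z, Cmod z < r -> U z) /\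
    exists mu0, 0 < mu0 /\
    (* (i) *)
    (forall mu, 0 < Rabs mu < mu0 -> mu * l1 > 0 ->
       (forall z, U z -> is_equilibrium (garland_field q alpha Phi Rf mu) z -> z = 0%C) /\
       is_center (garland_field q alpha Phi Rf mu) 0%C) /\
    (* (ii) *)
    exists (zk : R -> nat -> C) (theta : R -> nat -> R),
      (forall mu, 0 < Rabs mu < mu0 -> mu * l1 < 0 ->
         is_center (garland_field q alpha Phi Rf mu) 0%C /\
         (forall k, (k < 4 * q)%nat ->
            U (zk mu k) /\ zk mu k <> 0%C /\
            is_equilibrium (garland_field q alpha Phi Rf mu) (zk mu k) /\
            zk mu k = (RtoC (Cmod (zk mu k)) * ((cos (theta mu k), sin (theta mu k)) : C))%C) /\
         (forall j k, (j < 4 * q)%nat -> (k < 4 * q)%nat -> zk mu j = zk mu k -> j = k) /\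
         (forall z, U z -> z <> 0%C -> is_equilibrium (garland_field q alpha Phi Rf mu) z ->
            exists k, (k < 4 * q)%nat /\ z = zk mu k) /\
         (alpha * l1 > 0 -> forall k, (k < 4 * q)%nat ->
            (Nat.even k = true -> is_saddle (garland_field q alpha Phi Rf mu) (zk mu k)) /\
            (Nat.even k = false -> is_center (garland_field q alpha Phi Rf mu) (zk mu k))) /\
         (alpha * l1 < 0 -> forall k, (k < 4 * q)%nat ->
            (Nat.even k = true -> is_center (garland_field q alpha Phi Rf mu) (zk mu k)) /\
            (Nat.even k = false -> is_saddle (garland_field q alpha Phi Rf mu) (zk mu k)))) /\
      (* |z_k|^2 = -mu/l1 + O(mu^2) *)
      (exists K, forall mu k, 0 < Rabs mu < mu0 -> mu * l1 < 0 -> (k < 4 * q)%nat ->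
         Rabs (Cmod (zk mu k) ^ 2 + mu / l1) <= K * mu ^ 2) /\
      (* arg z_k = k pi / (2q) + o(1) *)
      (forall k, (k < 4 * q)%nat -> forall eps, 0 < eps -> exists d, 0 < d /\
         forall mu, 0 < Rabs mu < Rmin d mu0 -> mu * l1 < 0 ->
           Rabs (theta mu k - INR k * PI / (2 * INR q)) < eps).
Proof.
destruct (flat_components Rf (2 * q + 1) HR0) as [K [d [Hd Hflat]]].
set (j := (2 * q - 4)%nat).
assert (Hq : (2 * q = j + 4)%nat) by (unfold j; lia).
assert (Hj : (2 <= j)%nat) by (unfold j; lia).
replace (2 * q + 1)%nat with (j + 5)%nat in Hflat by lia.
assert (HPhi00 : Phi 0 = 0).
{ destruct HPhi0 as [K' [d' [Hd' H]]].
  assert (H0 := H 0 ltac:(rewrite Rabs_R0; lra)).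
  replace (Phi 0 - l1 * 0) with (Phi 0) in H0 by ring.
  replace (K' * 0 ^ 2) with 0 in H0 by ring.
  apply Rabs_eq_0; assert (H1 := Rabs_pos (Phi 0)); lra. }
set (w := 2 * INR q).
destruct (error_bounds l1 alpha w K d j Phi (Rre Rf) (Rim Rf) Hj Hl1 Halpha HPhi HPhi0
            (proj1 HR) (proj2 HR) Hd Hflat) as [Ce [de [Hde HE]]].
destruct (equilibrium_determinant q j l1 alpha Phi Rf K d Hq Hj Hl1 Halpha HPhi HPhi0 HR Hd
            Hflat) as [dd [Hdd HD]].
destruct (origin_is_center q j alpha Phi Rf K d Hq HPhi HPhi00 HR Hd Hflat)
  as [dc [Hdc HC]].
fold w in HD.
assert (HP := PI2_3_2).
assert (Hw : 6 <= w).
{ unfold w; assert (H := le_INR 3 q Hq3); simpl in H; lra. }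
set (C1 := Rabs Ce + 1).
assert (HC1 : 1 <= C1) by (unfold C1; assert (H := Rabs_pos Ce); lra).
assert (Hal1 := Rabs_pos_lt l1 Hl1).
(* The radius of [U]. The bounds 1 and 1 / (16 C1) give C1 a^2 <= C1 a <= 1/16, the tolerance of the
   sector analysis. *)
set (r0 := Rmin (Rmin 1 (/ (16 * C1))) (Rmin de dd)).
assert (Hr0 : 0 < r0).
{ repeat apply Rmin_glb_lt; try lra; apply Rinv_0_lt_compat; lra. }
assert (Hmin : forall a b c, a < Rmin b c -> a < b /\ a < c).
{ intros a b c H; split; (eapply Rlt_le_trans; [exact H|]); [apply Rmin_l|apply Rmin_r]. }
(* The last entry makes the reference radius sqrt (- mu / l1) smaller than r0 / 2, so that all
   points with r <= 2 at this scale lie in [U]. *)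
set (mu0 := Rmin (Rmin de dd) (Rmin dc (Rabs l1 * (r0 / 2) ^ 2))).
assert (Hmu0 : 0 < mu0).
{ repeat apply Rmin_glb_lt; try lra; apply Rmult_lt_0_compat; [exact Hal1|].
  apply pow_lt; lra. }
set (E1 := radial_error l1 alpha w j Phi (Rre Rf) (Rim Rf)).
set (E2 := angular_error alpha j (Rre Rf) (Rim Rf)).
assert (Hbl : forall a mu, 0 < a < r0 -> Rabs mu < mu0 ->
  bounded_lip (C1 * a ^ 2) (E1 a mu) /\ bounded_lip (C1 * a ^ 2) (E2 a mu) /\
  C1 * a ^ 2 <= 1 / 16).
{ intros a mu [Ha1 Ha2] Hmu.
  apply Hmin in Ha2; destruct Ha2 as [A1 A2].
  apply Hmin in A1; apply Hmin in A2; destruct A1 as [A1 A3]; destruct A2 as [A2 _].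
  apply Hmin in Hmu; destruct Hmu as [M1 _]; apply Hmin in M1; destruct M1 as [M1 _].
  destruct (HE a mu ltac:(lra) M1) as [B1 B2].
  assert (Hc : Ce * a ^ 2 <= C1 * a ^ 2).
  { apply Rmult_le_compat_r; [apply pow2_ge_0|].
    unfold C1; assert (H := Rle_abs Ce); lra. }
  split; [exact (bounded_lip_weaken _ _ _ Hc B1)|].
  split; [exact (bounded_lip_weaken _ _ _ Hc B2)|].
  apply Rle_trans with (C1 * a).
  - apply Rmult_le_compat_l; [lra|]; nra.
  - replace (1 / 16) with (C1 * / (16 * C1)) by (field; lra).
    apply Rmult_le_compat_l; lra. }
assert (Hpol : forall mu a r t, 0 < a -> 0 < r ->
  is_equilibrium (garland_field q alpha Phi Rf mu) (a * r * cos t, a * r * sin t) <->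
  mu + l1 * a ^ 2 * (r ^ 2 + E1 a mu r t) = 0 /\ sin (w * t) + E2 a mu r t = 0).
{ intros mu a r t Ha Hr; exact (polar_equilibrium q j l1 alpha Phi Rf mu a r t Hq Hl1 Halpha Ha Hr). }
set (rad := fun mu => sqrt (- mu / l1)).
assert (Hrad : forall mu, Rabs mu < mu0 -> mu * l1 < 0 ->
          0 < rad mu < r0 / 2 /\ rad mu ^ 2 = - mu / l1).
{ intros mu Hmu Hs.
  assert (Hpos : 0 < - mu / l1).
  { replace (- mu / l1) with (- (mu * l1) / (l1 * l1)) by (field; exact Hl1).
    apply Rdiv_lt_0_compat; [lra|exact (Rsqr_pos_lt l1 Hl1)]. }
  assert (H2 : rad mu ^ 2 = - mu / l1) by (apply pow2_sqrt; lra).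
  assert (H0 : 0 < rad mu) by (apply sqrt_lt_R0; exact Hpos).
  split; [split; [exact H0|]|exact H2].
  apply Hmin in Hmu; destruct Hmu as [_ M1]; apply Hmin in M1; destruct M1 as [_ M1].
  assert (H3 : rad mu ^ 2 < (r0 / 2) ^ 2).
  { rewrite H2, <- (Rabs_pos_eq (- mu / l1)), Rabs_div, Rabs_Ropp by lra.
    apply (Rmult_lt_reg_l (Rabs l1)); [exact Hal1|].
    replace (Rabs l1 * (Rabs mu / Rabs l1)) with (Rabs mu) by (field; lra); exact M1. }
  apply Rnot_le_lt; intros H4.
  assert ((r0 / 2) ^ 2 <= rad mu ^ 2) by (apply pow_incr; lra); lra. }
set (ang := fun (k : nat) psi => (INR k * PI + psi) / w).
set (root := fun mu k r psi => r ^ 2 - 1 + E1 (rad mu) mu r (ang k psi) = 0 /\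
                sin (w * ang k psi) + E2 (rad mu) mu r (ang k psi) = 0).
set (pt := fun mu k r psi =>
  (rad mu * r * cos (ang k psi), rad mu * r * sin (ang k psi)) : C).
assert (Hroot : forall mu k r psi, Rabs mu < mu0 -> mu * l1 < 0 -> 0 < r ->
  is_equilibrium (garland_field q alpha Phi Rf mu) (pt mu k r psi) <-> root mu k r psi).
{ intros mu k r psi Hmu Hs Hr; destruct (Hrad mu Hmu Hs) as [Ha Ha2].
  unfold pt, root; rewrite Hpol by lra.
  assert (Hla : l1 * rad mu ^ 2 <> 0).
  { apply Rmult_integral_contrapositive; split; [exact Hl1|apply pow_nonzero; lra]. }
  assert (Hm : mu + l1 * rad mu ^ 2 * (r ^ 2 + E1 (rad mu) mu r (ang k psi)) =
               l1 * rad mu ^ 2 * (r ^ 2 - 1 + E1 (rad mu) mu r (ang k psi))).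
  { rewrite Ha2; field; exact Hl1. }
  rewrite Hm; split; intros [R1 R2]; (split; [|exact R2]).
  - apply (Rmult_eq_reg_l _ _ _ (eq_trans R1 (eq_sym (Rmult_0_r _)))); exact Hla.
  - rewrite R1; ring. }
assert (Hsec : forall mu k, Rabs mu < mu0 -> mu * l1 < 0 ->
  (exists r psi, 1 / 2 <= r <= 2 /\ Rabs psi <= PI / 3 /\ root mu k r psi) /\
  (forall r psi r' psi', 1 / 2 <= r <= 2 -> Rabs psi <= PI / 3 ->
     1 / 2 <= r' <= 2 -> Rabs psi' <= PI / 3 ->
     root mu k r psi -> root mu k r' psi' -> r = r' /\ psi = psi')).
{ intros mu k Hmu Hs; destruct (Hrad mu Hmu Hs) as [Ha _].
  destruct (Hbl (rad mu) mu ltac:(lra) Hmu) as [B1 [B2 B3]].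
  exact (sector_root w _ k _ _ ltac:(lra) B3 B1 B2). }
(* At scale |z| and r = 1 the radial equation reads mu = - l1 |z|^2 (1 + x1) with |x1| <= 1/16. This
   forces mu l1 < 0, which settles (i), and only then makes the reference scale available. *)
assert (Hloc : forall mu z, Rabs mu < mu0 -> Cmod z < r0 -> z <> 0%C ->
  is_equilibrium (garland_field q alpha Phi Rf mu) z ->
  mu * l1 < 0 /\ exists k r psi, (k < 4 * q)%nat /\ 1 / 2 <= r <= 2 /\ Rabs psi <= PI / 3 /\
    root mu k r psi /\ z = pt mu k r psi).
{ intros mu z Hmu Hz Hz0 Heq.
  set (a := Cmod z) in *.
  assert (Ha : 0 < a) by (apply Cmod_gt_0; exact Hz0).
  destruct (polar_form z) as [t0 [Ht0 Hzt]]; fold a in Hzt.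
  destruct (nearest_sector q t0 ltac:(lia) Ht0) as [k [psi [Hk [Hpsi [Hc Hsn]]]]].
  fold w in Hc, Hsn; fold (ang k psi) in Hc, Hsn.
  rewrite <- Hc, <- Hsn in Hzt.
  destruct (Hbl a mu ltac:(lra) Hmu) as [B1 [B2 B3]].
  assert (Heq' := Heq); rewrite Hzt, <- (Rmult_1_r a) in Heq'.
  apply Hpol in Heq'; [|exact Ha|lra]; destruct Heq' as [R1 R2].
  destruct (B1 1 (ang k psi) 1 0 ltac:(lra) ltac:(lra)) as [e1 _].
  destruct (B2 1 (ang k psi) 1 0 ltac:(lra) ltac:(lra)) as [e2 _].
  set (x1 := E1 a mu 1 (ang k psi)) in *; set (x2 := E2 a mu 1 (ang k psi)) in *.
  assert (Hx1 : - (1 / 16) <= x1 <= 1 / 16) by (apply Rabs_le_between; lra).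
  assert (Hmu1 : mu = - (l1 * (a ^ 2 * (1 + x1)))).
  { replace (l1 * (a ^ 2 * (1 + x1))) with (l1 * a ^ 2 * (1 ^ 2 + x1)) by ring; lra. }
  assert (Ha2 : 0 < a ^ 2 * (1 + x1)).
  { apply Rmult_lt_0_compat; [apply pow_lt; exact Ha|lra]. }
  assert (Hs : mu * l1 < 0).
  { rewrite Hmu1.
    replace (- (l1 * (a ^ 2 * (1 + x1))) * l1) with (- (a ^ 2 * (1 + x1) * (l1 * l1))) by ring.
    assert (0 < a ^ 2 * (1 + x1) * (l1 * l1)); [|lra].
    apply Rmult_lt_0_compat; [exact Ha2|exact (Rsqr_pos_lt l1 Hl1)]. }
  split; [exact Hs|].
  destruct (Hrad mu Hmu Hs) as [Hb Hb2]; set (b := rad mu) in *.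
  assert (Hab : b ^ 2 = a ^ 2 * (1 + x1)) by (rewrite Hb2, Hmu1; field; exact Hl1).
  assert (Hpsi3 : Rabs psi <= PI / 3).
  { apply small_sine; [exact Hpsi|].
    assert (Hwk : w * ang k psi = INR k * PI + psi) by (unfold ang; field; lra).
    destruct (sin_cos_add_kPI k psi) as [S1 _]; rewrite <- Hwk in S1.
    replace (Rabs (sin psi)) with (Rabs (sin (w * ang k psi))).
    - replace (sin (w * ang k psi)) with (- x2) by lra; rewrite Rabs_Ropp; lra.
    - rewrite S1, Rabs_mult, pow_1_abs; ring. }
  (* b^2 = a^2 (1 + x1) puts the ratio of the two scales close to 1, hence inside the annulus where
     roots are unique. *)
  assert (Hr : 1 / 2 <= a / b <= 2).
  { assert (Hba : b <= 2 * a).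
    { apply Rnot_lt_le; intros H; nra. }
    assert (Hab' : a <= 2 * b).
    { apply Rnot_lt_le; intros H; nra. }
    split; apply (Rmult_le_reg_r b); try lra; replace (a / b * b) with a by (field; lra); lra. }
  assert (Hpt : z = pt mu k (a / b) psi).
  { unfold pt; fold b; replace (b * (a / b)) with a by (field; lra); exact Hzt. }
  exists k, (a / b), psi; split; [exact Hk|]; split; [exact Hr|]; split; [exact Hpsi3|].
  split; [|exact Hpt]; apply Hroot; [exact Hmu|exact Hs|lra|]; rewrite <- Hpt; exact Heq. }
(* One choice over all pairs (mu, k) makes the equilibria functions of mu, as the asymptotic claims
   require; (0, 0) is a default for inadmissible mu. *)
assert (Hsel : forall p : R * nat, exists c : R * R, Rabs (fst p) < mu0 -> fst p * l1 < 0 ->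
  1 / 2 <= fst c <= 2 /\ Rabs (snd c) <= PI / 3 /\ root (fst p) (snd p) (fst c) (snd c)).
{ intros [mu k]; cbn [fst snd].
  destruct (Rlt_dec (Rabs mu) mu0) as [Hmu|Hmu]; [destruct (Rlt_dec (mu * l1) 0) as [Hs|Hs]|].
  2, 3: exists (0, 0); intros; contradiction.
  destruct (Hsec mu k Hmu Hs) as [[r [psi H]] _].
  exists (r, psi); intros _ _; exact H. }
set (sel := fun mu k => proj1_sig (constructive_indefinite_description _ (Hsel (mu, k)))).
assert (Hsel' : forall mu k, Rabs mu < mu0 -> mu * l1 < 0 ->
  1 / 2 <= fst (sel mu k) <= 2 /\ Rabs (snd (sel mu k)) <= PI / 3 /\
  root mu k (fst (sel mu k)) (snd (sel mu k))).
{ intros mu k; exact (proj2_sig (constructive_indefinite_description _ (Hsel (mu, k)))). }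
clearbody sel.
set (zk := fun mu k => pt mu k (fst (sel mu k)) (snd (sel mu k))).
set (theta := fun mu k => ang k (snd (sel mu k))).
assert (Hmod : forall mu k, Rabs mu < mu0 -> mu * l1 < 0 ->
          Cmod (zk mu k) = rad mu * fst (sel mu k)).
{ intros mu k Hmu Hs; destruct (Hsel' mu k Hmu Hs) as [Hr _]; destruct (Hrad mu Hmu Hs) as [Ha _].
  apply Cmod_polar, Rmult_le_pos; lra. }
assert (Heqk : forall mu k, Rabs mu < mu0 -> mu * l1 < 0 ->
          is_equilibrium (garland_field q alpha Phi Rf mu) (zk mu k)).
{ intros mu k Hmu Hs; destruct (Hsel' mu k Hmu Hs) as [Hr [_ H]].
  apply Hroot; [exact Hmu|exact Hs|lra|exact H]. }
assert (Hsmall : forall mu k, Rabs mu < mu0 -> mu * l1 < 0 -> 0 < Cmod (zk mu k) < r0).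
{ intros mu k Hmu Hs; rewrite Hmod by assumption.
  destruct (Hsel' mu k Hmu Hs) as [Hr _]; destruct (Hrad mu Hmu Hs) as [Ha _].
  split; [apply Rmult_lt_0_compat; lra|].
  apply Rle_lt_trans with (rad mu * 2); [apply Rmult_le_compat_l; lra|lra]. }
(* In the k-th sector cos (2 q t) = (-1)^k cos psi; the positive factor cos psi is divided out, so
   only the parity of [k] affects the sign. *)
assert (Hdet : forall mu k, Rabs mu < mu0 -> mu * l1 < 0 ->
  l1 * alpha * (-1) ^ k * jac_det (garland_field q alpha Phi Rf mu) (zk mu k) < 0).
{ intros mu k Hmu Hs.
  assert (Hwk : w * theta mu k = INR k * PI + snd (sel mu k)) by (unfold theta, ang; field; lra).
  destruct (Hsel' mu k Hmu Hs) as [Hr [Hpsi _]].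
  assert (Hcp := cos_ge_half _ Hpsi).
  destruct (sin_cos_add_kPI k (snd (sel mu k))) as [_ S1]; rewrite <- Hwk in S1.
  assert (Hm := Hsmall mu k Hmu Hs); rewrite Hmod in Hm by assumption.
  destruct Hm as [Hm1 Hm2]; apply Hmin in Hm2; destruct Hm2 as [_ Hm2]; apply Hmin in Hm2.
  assert (Hmu' := Hmu); apply Hmin in Hmu'; destruct Hmu' as [M1 _]; apply Hmin in M1.
  assert (H := HD mu (rad mu * fst (sel mu k)) (theta mu k) (proj2 M1) (conj Hm1 (proj2 Hm2))
                 (Heqk mu k Hmu Hs)).
  rewrite S1, Rabs_mult, pow_1_abs, Rmult_1_l in H.
  assert (H1 := H (Rle_trans _ _ _ Hcp (Rle_abs _))).
  change (rad mu * fst (sel mu k) * cos (theta mu k), rad mu * fst (sel mu k) * sin (theta mu k))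
    with (zk mu k) in H1.
  apply (Rmult_lt_reg_r (cos (snd (sel mu k)))); [lra|].
  rewrite Rmult_0_l; eapply Rle_lt_trans; [right|exact H1]; ring. }
assert (Hpart : forall mu z, has_partials (garland_field q alpha Phi Rf mu) z).
{ intros mu [x y]; apply (garland_jacobian q alpha Phi Rf mu x y HPhi HR). }
assert (Hcen : forall mu k, Rabs mu < mu0 -> mu * l1 < 0 -> l1 * alpha * (-1) ^ k < 0 ->
  is_center (garland_field q alpha Phi Rf mu) (zk mu k)).
{ intros mu k Hmu Hs Hsg; apply center_of_det_pos; auto.
  assert (H := Hdet mu k Hmu Hs); apply Rnot_le_lt; intros H0; nra. }
assert (Hsad : forall mu k, Rabs mu < mu0 -> mu * l1 < 0 -> 0 < l1 * alpha * (-1) ^ k ->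
  is_saddle (garland_field q alpha Phi Rf mu) (zk mu k)).
{ intros mu k Hmu Hs Hsg; apply saddle_of_det_neg; auto.
  assert (H := Hdet mu k Hmu Hs); apply Rnot_le_lt; intros H0; nra. }
assert (Hcen0 : forall mu, 0 < Rabs mu < mu0 ->
  is_center (garland_field q alpha Phi Rf mu) 0%C).
{ intros mu [H1 H2]; apply HC; [|apply Hdiv]; split; [exact H1|].
  apply Hmin in H2; destruct H2 as [_ H2]; apply Hmin in H2; apply H2. }
exists (fun z => Cmod z < r0); split; [exists r0; auto|].
exists mu0; split; [exact Hmu0|]; split.
{ intros mu Hmu Hs; split; [|exact (Hcen0 mu Hmu)].
  intros z Hz Heq; destruct (classic (z = 0%C)) as [|Hz0]; [assumption|exfalso].
  destruct (Hloc mu z ltac:(lra) Hz Hz0 Heq) as [H _]; lra. }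
exists zk, theta; split; [|split].
- intros mu Hmu Hs; split; [exact (Hcen0 mu Hmu)|]; destruct Hmu as [_ Hmu].
  split; [|split; [|split; [|split]]].
  + intros k _; assert (Hm := Hsmall mu k Hmu Hs); split; [apply Hm|].
    split; [intros H; rewrite H, Cmod_0 in Hm; lra|]; split; [apply Heqk; assumption|].
    rewrite Hmod by assumption; unfold zk, pt, theta, RtoC, Cmult; cbn [fst snd].
    f_equal; ring.
  + intros i k Hi Hk Heq.
    destruct (Hsel' mu i Hmu Hs) as [Hr [Hpsi _]]; destruct (Hsel' mu k Hmu Hs) as [Hr' [Hpsi' _]].
    assert (Hm := Hsmall mu i Hmu Hs).
    assert (Hmm : rad mu * fst (sel mu i) = rad mu * fst (sel mu k)).
    { rewrite <- !Hmod, Heq by assumption; reflexivity. }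
    rewrite Hmod in Hm by assumption.
    unfold zk, pt in Heq; injection Heq as Hc Hsn; rewrite <- Hmm in Hc, Hsn.
    apply Rmult_eq_reg_l in Hc; [|lra]; apply Rmult_eq_reg_l in Hsn; [|lra].
    set (p := snd (sel mu i)) in *; set (p' := snd (sel mu k)) in *.
    apply Rabs_le_between in Hpsi; apply Rabs_le_between in Hpsi'.
    (* As 2w = 4q, two indices differ by at most 2w - 1, and the offsets psi differ by at most 2 PI
       / 3 < PI. Angles thus differ by less than 2 PI, and equal angles leave an index difference
       below 1. *)
    assert (Hin : forall n, (n < 4 * q)%nat -> 0 <= INR n <= 2 * w - 1).
    { intros n Hn; split; [apply pos_INR|].
      assert (Hn' := le_INR (n + 1) (4 * q) ltac:(lia)).
      rewrite plus_INR, mult_INR in Hn'; unfold w; simpl in Hn'; lra. }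
    assert (I1 := Hin i Hi); assert (I2 := Hin k Hk).
    assert (Hdiff : ang i p - ang k p' = ((INR i - INR k) * PI + (p - p')) / w)
      by (unfold ang; field; lra).
    assert (Hb : - ((2 * w - 1) * PI) <= (INR i - INR k) * PI <= (2 * w - 1) * PI).
    { split; [rewrite Ropp_mult_distr_l|]; apply Rmult_le_compat_r; lra. }
    assert (Hang : ang i p = ang k p').
    { apply angle_unique; [|exact Hc|exact Hsn].
      rewrite Hdiff, Rabs_div, (Rabs_pos_eq w) by lra.
      apply (Rmult_lt_reg_r w); [lra|].
      match goal with |- ?X / w * w < _ => replace (X / w * w) with X by (field; lra) end.
      apply Rabs_def1; lra. }
    assert (H0 : (INR i - INR k) * PI + (p - p') = 0).
    { replace (_ + _) with (w * (ang i p - ang k p')) by (rewrite Hdiff; field; lra).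
      rewrite Hang; ring. }
    assert (H1 : - 1 < INR i - INR k < 1).
    { split; apply (Rmult_lt_reg_r PI); lra. }
    destruct (Nat.lt_trichotomy i k) as [H|[H|H]]; [|exact H|]; exfalso.
    * assert (H2 := le_INR (i + 1) k ltac:(lia)); rewrite plus_INR in H2; simpl in H2; lra.
    * assert (H2 := le_INR (k + 1) i ltac:(lia)); rewrite plus_INR in H2; simpl in H2; lra.
  + intros z Hz Hz0 Heq.
    destruct (Hloc mu z Hmu Hz Hz0 Heq) as [_ [k [r [psi [Hk [Hr [Hpsi [HR1 Hpt]]]]]]]].
    exists k; split; [exact Hk|].
    destruct (Hsel' mu k Hmu Hs) as [Hr' [Hpsi' HR2]].
    destruct (proj2 (Hsec mu k Hmu Hs) _ _ _ _ Hr Hpsi Hr' Hpsi' HR1 HR2) as [E E'].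
    rewrite Hpt, E, E'; reflexivity.
  + intros Hsg k _; destruct (pow_minus_one_parity k) as [P1 P2].
    split; intros Hk; [apply Hsad|apply Hcen]; auto; [rewrite P1 by exact Hk|rewrite P2 by exact Hk]; lra.
  + intros Hsg k _; destruct (pow_minus_one_parity k) as [P1 P2].
    split; intros Hk; [apply Hcen|apply Hsad]; auto; [rewrite P1 by exact Hk|rewrite P2 by exact Hk]; lra.
(* With rho = [rad mu] the deviation is rho^2 (r^2 - 1) = - rho^2 E1, at most C1 rho^4 = C1 mu^2 /
   l1^2. *)
- exists (C1 / l1 ^ 2); intros mu k [_ Hmu] Hs _; rewrite Hmod by assumption.
  destruct (Hsel' mu k Hmu Hs) as [Hr [_ [HR1 _]]]; destruct (Hrad mu Hmu Hs) as [Ha Ha2].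
  destruct (Hbl (rad mu) mu ltac:(lra) Hmu) as [B1 _].
  destruct (B1 (fst (sel mu k)) (ang k (snd (sel mu k))) 1 0 Hr ltac:(lra)) as [e1 _].
  replace ((rad mu * fst (sel mu k)) ^ 2 + mu / l1)
    with (- (rad mu ^ 2 * E1 (rad mu) mu (fst (sel mu k)) (ang k (snd (sel mu k))))).
  + rewrite Rabs_Ropp, Rabs_mult, (Rabs_pos_eq (rad mu ^ 2)) by apply pow2_ge_0.
    replace (C1 / l1 ^ 2 * mu ^ 2) with (rad mu ^ 2 * (C1 * rad mu ^ 2))
      by (rewrite Ha2; field; exact Hl1).
    apply Rmult_le_compat_l; [apply pow2_ge_0|exact e1].
  + replace (mu / l1) with (- rad mu ^ 2) by (rewrite Ha2; field; exact Hl1).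
    replace (E1 (rad mu) mu (fst (sel mu k)) (ang k (snd (sel mu k))))
      with (1 - fst (sel mu k) ^ 2) by lra; ring.
(* The threshold inverts |psi| <= 2 |sin psi| <= 2 C1 |mu| / |l1|; the deviation of the argument is
   psi / w, hence even O(mu). *)
- intros k _ eps Heps; exists (eps * Rabs l1 / (2 * C1)).
  split; [apply Rdiv_lt_0_compat; [apply Rmult_lt_0_compat; lra|lra]|].
  intros mu [_ Hmu] Hs; apply Hmin in Hmu; destruct Hmu as [Hmu1 Hmu].
  destruct (Hsel' mu k Hmu Hs) as [Hr [Hpsi [_ HR2]]]; destruct (Hrad mu Hmu Hs) as [Ha Ha2].
  destruct (Hbl (rad mu) mu ltac:(lra) Hmu) as [_ [B2 _]].
  destruct (B2 (fst (sel mu k)) (ang k (snd (sel mu k))) 1 0 Hr ltac:(lra)) as [e2 _].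
  set (p := snd (sel mu k)) in *.
  assert (Hwk : w * ang k p = INR k * PI + p) by (unfold ang; field; lra).
  destruct (sin_cos_add_kPI k p) as [S1 _]; rewrite <- Hwk in S1.
  assert (S2 : Rabs (sin p) <= C1 * rad mu ^ 2).
  { replace (Rabs (sin p)) with (Rabs (sin (w * ang k p))) by (rewrite S1, Rabs_mult, pow_1_abs; ring).
    replace (sin (w * ang k p)) with (- E2 (rad mu) mu (fst (sel mu k)) (ang k p)) by lra.
    rewrite Rabs_Ropp; exact e2. }
  assert (S3 := sin_expanding p 0 Hpsi); rewrite sin_0, !Rminus_0_r, Rabs_R0 in S3.
  assert (S4 := S3 ltac:(lra)).
  change (theta mu k) with (ang k p); fold w.
  replace (ang k p - INR k * PI / w) with (p / w) by (unfold ang; field; lra).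
  apply Rle_lt_trans with (Rabs p).
  + apply Rabs_div_le; [lra|]; rewrite <- (Rmult_1_r (Rabs p)) at 1.
    apply Rmult_le_compat_l; [apply Rabs_pos|lra].
  + apply Rle_lt_trans with (2 * (C1 * rad mu ^ 2)); [lra|].
    rewrite <- (Rabs_pos_eq (rad mu ^ 2)) by apply pow2_ge_0.
    rewrite Ha2, Rabs_div, Rabs_Ropp by exact Hl1.
    apply (Rmult_lt_compat_r (2 * C1 / Rabs l1)) in Hmu1.
    2: apply Rdiv_lt_0_compat; lra.
    replace (2 * (C1 * (Rabs mu / Rabs l1))) with (Rabs mu * (2 * C1 / Rabs l1)) by (field; lra).
    eapply Rlt_le_trans; [exact Hmu1|]; right; field; lra.
Qed.
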